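(* Let $(\Omega,\mathcal{F},\mu;(\mathcal{F}_i)_{i\in\mathbb{Z}})$ be a $\sigma$-finite filtered measure space, let $\alpha=(\alpha_i)_{i\in\mathbb{Z}}$ where each $\alpha_i$ is a nonnegative bounded $\mathcal{F}_i$-measurable function, let $1<p\leq q<\infty$, and let $\omega,\sigma$ be weights with $\omega\in A_1$ and $\sigma\in A_1$. Then the following statements are equivalent: (1) There exists a positive constant $C$ such that for all nonnegative $f\in L^p(\sigma)$ and $g\in L^{q'}(\omega)$, $$\|T_{\alpha}(f\sigma,g\omega)\|_{L^1(d\mu)}\leq C\|f\|_{L^p(\sigma)}\|g\|_{L^{q'}(\omega)}. \qquad (a)$$ (2) There exist positive constants $C_1$ and $C_2$ such that for every $i\in\mathbb{Z}$ and every $E\in\mathcal{F}_i^0$, $$\Big(\int_E\Big(\sum_{j\geq i}\mathbb{E}_j(\sigma)\alpha_j\Big)^q\omega\, d\mu\Big)^{\frac1q}\leq C_1\,\sigma(E)^{\frac1p}, \qquad (b)$$ $$\Big(\int_E\Big(\sum_{j\geq i}\mathbb{E}_j(\omega)\alpha_j\Big)^{p'}\sigma\, d\mu\Big)^{\frac1{p'}}\leq C_2\,\omega(E)^{\frac1{q'}}. \qquad (c)$$ Moreover, denoting the smallest constants $C$, $C_1$, $C_2$ in (a), (b), (c) by $\|T_\alpha(\cdot\,\sigma)\|$, $[\omega,\sigma]_{\alpha,q',p'}$ and $[\sigma,\omega]_{\alpha,p,q}$, respectively, one has $$[\omega,\sigma]_{\alpha,q',p'}\leq\|T_\alpha(\cdot\,\sigma)\|,\qquad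 [\sigma,\omega]_{\alpha,p,q}\leq\|T_\alpha(\cdot\,\sigma)\|,$$ and $$\|T_\alpha(\cdot\,\sigma)\|\lesssim[\omega,\sigma]_{\alpha,q',p'}[\omega]_{A_1}+[\sigma,\omega]_{\alpha,p,q}[\sigma]_{A_1}.$$
   Context: A $\sigma$-finite filtered measure space $(\Omega,\mathcal{F},\mu;(\mathcal{F}_i)_{i\in\mathbb{Z}})$ consists of a measure space with sub-$\sigma$-algebras $\mathcal{F}_i\subset\mathcal{F}$, $i\in\mathbb{Z}$, such that $\mathcal{F}_i\subset\mathcal{F}_j$ for $i<j$; all measure spaces, including every $(\Omega,\mathcal{F}_i,\mu)$, are assumed $\sigma$-finite. $\mathcal{F}_i^0$ denotes the collection of sets in $\mathcal{F}_i$ of finite $\mu$-measure. $\mathcal{L}$ is the set of $\mathcal{F}$-measurable functions $f:\Omega\to\mathbb{R}$ such that $\chi_E f\in L^1(\mathcal{F},\mu)$ for all $E\in\mathcal{F}_i^0$ and all $i\in\mathbb{Z}$. For $f\in\mathcal{L}$, $\mathbb{E}_i(f)=\mathbb{E}(f|\mathcal{F}_i)$ is the conditional expectation: the a.e. unique $\mathcal{F}_i$-measurable function, integrable on every $G\in\mathcal{F}_i^0$, with $\int_G \mathbb{E}_i(f)\,d\mu=\int_G f\,d\mu$ for all $G\in\mathcal{F}_i^0$. A weight is a nonnegative function in $\mathcal{L}$. For a weight $w$, $w(E)=\int_E w\,d\mu$ and $L^p(w)=L^p(\Omega,w\,d\mu)$. A weight $v$ satisfies $A_1$ if there is $C>0$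 with $\sup_{j\in\mathbb{Z}}\mathbb{E}_j(v)\leq Cv$ ($\mu$-a.e.); the smallest such $C$ is $[v]_{A_1}$. The bilinear positive operator is $T_\alpha(f,g)=\sum_{i\in\mathbb{Z}}\alpha_i\,\mathbb{E}_i(f)\,\mathbb{E}_i(g)$. The conjugate exponent of $p$ is $p'$, $\frac1p+\frac1{p'}=1$ (likewise $q'$). The notation $A\lesssim B$ means $A\leq CB$ with a constant $C$ independent of the weights and weight constants (it may depend on $p,q$). A smallest constant is understood as $+\infty$ if no finite constant works. *)

(* Defs.v *)
From HB Require Import structures.
From mathcomp Require Export all_boot all_order all_algebra.
From mathcomp Require Export all_classical all_reals all_analysis.

Set Implicit Arguments.
Unset Strict Implicit.
Unset Printing Implicit Defensive.

Import Order.TTheory GRing.Theory Num.Theory.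
Import numFieldNormedType.Exports.

Local Open Scope classical_set_scope.
Local Open Scope ring_scope.
Local Open Scope ereal_scope.

Section filtered_measure_space.
Context {d : measure_display} {T : measurableType d} {R : realType}.
Variable mu : {sigma_finite_measure set T -> \bar R}.

(* [g_sigma_algebraType G] is [T] equipped with the sigma-algebra generated by
   [G], which is [G] itself when [G] is a sigma-algebra. *)
Definition measurable_wrt (G : set (set T)) (f : T -> R) : Prop :=
  measurable_fun [set: g_sigma_algebraType G]
    (f : g_sigma_algebraType G -> R).

Record sigma_finite_filtration (F : int -> set (set T)) : Prop := {
  filtration_sigma_algebra : forall i, sigma_algebra [set: T] (F i) ;
  filtration_measurable : forall i, F i `<=` measurable ;
  filtration_nondecreasing : forall i j : int, (i < j)%R -> F i `<=` F j ;
  filtration_sigma_finite : forall i,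
    sigma_finite [set: g_sigma_algebraType (F i)]
      (mu : set (g_sigma_algebraType (F i)) -> \bar R) }.

Variable F : int -> set (set T).

Definition finite_sets (i : int) : set (set T) :=
  [set E | F i E /\ mu E < +oo].

Definition locally_integrable (f : T -> R) : Prop :=
  measurable_fun [set: T] f /\
  forall i E, finite_sets i E -> mu.-integrable E (EFin \o f).

Definition is_cond_exp (i : int) (f h : T -> R) : Prop :=
  [/\ measurable_wrt (F i) h,
      forall G, finite_sets i G -> mu.-integrable G (EFin \o h) &
      forall G, finite_sets i G ->
        \int[mu]_(x in G) (h x)%:E = \int[mu]_(x in G) (f x)%:E].

(* A version of E(f | F_i); it is unique only up to mu-negligible sets, and
   the default value 0 is used only when no version exists. *)
Definition cond_exp (i : int) (f : T -> R) : T -> R :=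
  xget (cst 0%R) [set h | is_cond_exp i f h].

Definition weight (w : T -> R) : Prop :=
  locally_integrable w /\ forall x, (0 <= w x)%R.

Definition weight_set (w : T -> R) (E : set T) : \bar R :=
  \int[mu]_(x in E) (w x)%:E.

(* The norm of L^p(w dmu), for a nonnegative [w] and a finite exponent [p]. *)
Definition weighted_Lnorm (p : R) (w f : T -> R) : \bar R :=
  (\int[mu]_x (`|f x| `^ p * w x)%:E) `^ p^-1.

Definition weighted_Lspace (p : R) (w : T -> R) : set (T -> R) :=
  [set f | measurable_fun [set: T] f /\ weighted_Lnorm p w f < +oo].

(* The infimum of the positive admissible constants, +oo if there is none. *)
Definition smallest_constant (P : R -> Prop) : \bar R :=
  ereal_inf [set C%:E | C in [set C : R | (0 < C)%R /\ P C]].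

Definition A1_bound (v : T -> R) (C : R) : Prop :=
  {ae mu, forall x,
    ereal_sup [set (cond_exp j v x)%:E | j in [set: int]] <= (C * v x)%:E}.

Definition A1 (v : T -> R) : Prop := exists2 C : R, (0 < C)%R & A1_bound v C.

Definition A1_constant (v : T -> R) : \bar R :=
  smallest_constant (A1_bound v).

Definition admissible_coefficients (alpha : int -> T -> R) : Prop :=
  forall i, [/\ measurable_wrt (F i) (alpha i),
                forall x, (0 <= alpha i x)%R &
                exists M : R, forall x, (alpha i x <= M)%R].

Variable alpha : int -> T -> R.

Definition bilinear_op (f g : T -> R) (x : T) : \bar R :=
  \esum_(i in [set: int])
    (alpha i x * cond_exp i f x * cond_exp i g x)%:E.

(* [r] is the exponent of the second factor, the conjugate q' of q. *)
Definition bilinear_bound (p r : R) (sigma omega : T -> R) (C : R) : Prop :=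
  forall f g : T -> R,
    (forall x, (0 <= f x)%R) -> weighted_Lspace p sigma f ->
    (forall x, (0 <= g x)%R) -> weighted_Lspace r omega g ->
    'N[mu]_1 [ bilinear_op (f \* sigma)%R (g \* omega)%R ] <=
      C%:E * weighted_Lnorm p sigma f * weighted_Lnorm r omega g.

(* [s] and [r] are the exponents carried by the weights [u] and [v]; the two
   dual conditions are [testing_bound p q sigma omega] and
   [testing_bound q' p' omega sigma]. *)
Definition testing_bound (s r : R) (u v : T -> R) (C : R) : Prop :=
  forall (i : int) (E : set T), finite_sets i E ->
    (\int[mu]_(x in E)
       ((\esum_(j in [set j : int | (i <= j)%R])
           (cond_exp j u x * alpha j x)%:E) `^ r * (v x)%:E)) `^ r^-1 <=
    C%:E * weight_set u E `^ s^-1.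

End filtered_measure_space.

(* Main.v *)
Require Import Defs.
From HB Require Import structures.
From mathcomp Require Import all_boot all_order all_algebra finmap.
From mathcomp Require Import all_classical all_reals all_analysis measurable_realfun.
From mathcomp Require Import ring lra zify.
Import Order.TTheory GRing.Theory Num.Theory.
Import numFieldNormedType.Exports.

Set Implicit Arguments.
Unset Strict Implicit.
Unset Printing Implicit Defensive.

Local Open Scope classical_set_scope.
Local Open Scope ring_scope.
Local Open Scope ereal_scope.

(** Why the theorem is true.

From the form to the tests ([testing_bound_of_bilinear]).  Let E belong to F_i
and take f = 1_E.  For j >= i the set E is F_j-measurable, so it can be pulled
through E_j: the j-th term of the form has the integral of
1_E alpha_j E_j(sigma) g omega ([int_localized]).  Summing over j >= i, the
form dominates the integral of 1_E S g omega, where S is the sum inside the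
test.  With g = 1_E min(S, n)^(q-1), both this integral and the norm of g are
governed by X_n, the integral of 1_E min(S, n)^q omega, and the hypothesis
reads X_n <= C sigma(E)^(1/p) X_n^(1/q').  The truncation makes X_n finite,
so a power of it can be cancelled ([poweR_cancel]), and n tends to infinity.
The second test follows by exchanging the two factors of the form.

From the tests to the form ([bilinear_bound_of_testing]).  By monotone
convergence it suffices to sum over a window i, i+1, ..., i+N and to integrate
over a set of F_i of finite measure; this set can be absorbed in the weights,
which then have finite mass.  Write E_n(f sigma) = f_n E_n(sigma) and
E_n(g omega) = g_n E_n(omega): f_n and g_n are the conditional expectations of
f and g for the measures sigma dmu and omega dmu ([cond_version_quotient]).
Since all other factors are F_n-measurable, the n-th term is the integral of
alpha_n E_n(sigma) f_n g_n against omega dmu, and also the integral of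
alpha_n E_n(omega) f_n g_n against sigma dmu.

At each point, a new stage for f starts whenever f_n exceeds twice its value
at the start of the current stage, and likewise for g.  The proof splits the
times n according to which of the two current stages started last.  Suppose
that it is the one of g, and let m be the start of the stage of f.  Then f_n
is at most 2 f_m, and g_n is at most twice a value of g at a stage start that
falls inside the stage of f beginning at m.  Grouping the times n by m gives a
sum over the stages of f of f_m Theta_m H_m, with Theta_m the sum of the
alpha_j E_j(sigma) over the window for j >= m, and H_m the l^q' norm of those
values of g ([stage_pairing]).  Each stage start of g lies in exactly one
stage of f, so the sum of the H_m^q' is the sum of g_l^q' over all the stage
starts of g; at stage starts the values at least double, so that this is at
most twice the q'-th power of the running maximum of the g_n, which Doob's
inequality controls ([doob_maximal]).  The function f_m is F_m-measurable, and
the test for sets E of F_m extends to F_m-measurable functions h in the form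
  int h^q Theta_m^q omega <= C^q (int h^p sigma)^(q/p),
because q/p >= 1 makes t^(q/p) superadditive ([le_int_gauge]); superadditivity
again allows summation over m, and Doob's inequality for f finishes
([half_of_the_sum]).  The other half of the times is the same statement with
the roles of f and g exchanged, and uses the second test.  The two powers
produced by Young's inequality are balanced by a free scaling parameter
([young_optimize]).

The constants.  This gives a bound for the norm of the form by a multiple of
the sum of the two testing constants.  If a weight v has an A_1 bound C < 1,
then integrating E_0(v) <= C v over sets of F_0 shows that v vanishes almost
everywhere ([A1_bound_lt1]), and then the form is zero; otherwise both A_1
constants are at least 1, and multiplying by them only enlarges the bound. *)

(** * Integrals of nonnegative measurable functions *)
Section nonnegative_measurable.
Context {d : measure_display} {T : measurableType d} {R : realType}.
Implicit Types u v : T -> R.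

(** Every integral estimated below is of such a function, so that integrability
never arises as a side condition. *)
Definition nnm u := measurable_fun [set: T] u /\ forall x, (0 <= u x)%R.

Lemma nnm_cst (c : R) : (0 <= c)%R -> nnm (fun=> c).
Proof. by move=> c0; split. Qed.

Lemma nnm_add u v : nnm u -> nnm v -> nnm (fun x => u x + v x)%R.
Proof.
move=> [mu0 u0] [mv v0]; split=> [|x]; first exact: measurable_funD.
exact: addr_ge0.
Qed.

Lemma nnm_mul u v : nnm u -> nnm v -> nnm (fun x => u x * v x)%R.
Proof.
move=> [mu0 u0] [mv v0]; split=> [|x]; first exact: measurable_funM.
exact: mulr_ge0.
Qed.

Lemma nnm_powR u (r : R) : nnm u -> nnm (fun x => u x `^ r)%R.
Proof.
move=> [mu0 u0]; split=> [|x]; last exact: powR_ge0.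
exact: (measurableT_comp (measurable_powR r) mu0).
Qed.

Lemma nnm_indic (E : set T) : measurable E -> nnm (\1_E : T -> R).
Proof. by move=> mE; split=> // x; rewrite indicE. Qed.

Lemma nnm_bool (b : T -> bool) :
  measurable_fun [set: T] b -> nnm (fun x => (b x)%:R : R)%R.
Proof.
move=> mb; rewrite (_ : (fun x => _) = \1_(b @^-1` [set true])).
  apply: nnm_indic; rewrite -[X in measurable X]setTI; exact: mb.
apply/funext => x; rewrite indicE; case: (boolP (b x)) => bx.
  by rewrite mem_set.
by rewrite memNset//=; apply/negP.
Qed.

Lemma nnm_max u v : nnm u -> nnm v -> nnm (fun x => Num.max (u x) (v x)).
Proof.
move=> [mu0 u0] [mv v0]; split=> [|x]; last by rewrite le_max u0.
exact: measurable_maxr.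
Qed.

Lemma nnm_min u v : nnm u -> nnm v -> nnm (fun x => Num.min (u x) (v x)).
Proof.
move=> [mu0 u0] [mv v0]; split=> [|x]; last by rewrite le_min u0 v0.
exact: measurable_minr.
Qed.

Lemma nnm_inv u : nnm u -> nnm (fun x => (u x)^-1)%R.
Proof.
move=> [mu0 u0]; split=> [|x]; last by rewrite invr_ge0.
rewrite (_ : (fun x => _) = (fun x => u x `^ (-1))%R).
  exact: (measurableT_comp (measurable_powR _) mu0).
by apply/funext => x; rewrite powR_inv1.
Qed.

Lemma nnm_sum (I : Type) (s : seq I) (P : pred I) (u : I -> T -> R) :
  (forall i, P i -> nnm (u i)) -> nnm (fun x => \sum_(i <- s | P i) u i x)%R.
Proof.
move=> nu; split=> [|x]; last first.
  apply: sumr_ge0 => i Pi; have [_ u0] := nu i Pi; exact: u0.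
elim: s => [|i s ih].
  by under eq_fun do rewrite big_nil; exact: measurable_cst.
under eq_fun do rewrite big_cons.
case Pi : (P i) => //; apply: measurable_funD => //.
by have [] := nu i Pi.
Qed.

Lemma nnm_ext u v : u =1 v -> nnm u -> nnm v.
Proof. by move=> /funext ->. Qed.

End nonnegative_measurable.

Section nonnegative_integral.
Context {d : measure_display} {T : measurableType d} {R : realType}.
Variable mu : {measure set T -> \bar R}.
Implicit Types u v : T -> R.

Let emeas u : nnm u -> measurable_fun [set: T] (EFin \o u).
Proof. by move=> [mu0 _]; apply/measurable_EFinP. Qed.

Lemma int_ge0 u : nnm u -> 0 <= \int[mu]_x (u x)%:E.
Proof. by move=> [_ u0]; apply: integral_ge0 => x _; rewrite lee_fin. Qed.

Lemma le_int u v : nnm u -> nnm v -> (forall x, (u x <= v x)%R) ->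
  \int[mu]_x (u x)%:E <= \int[mu]_x (v x)%:E.
Proof.
move=> nu nv uv; apply: ge0_le_integral => //.
- by move=> x _; rewrite lee_fin; exact: nu.2.
- exact: emeas.
- exact: emeas.
- by move=> x _; rewrite lee_fin.
Qed.

Lemma intD u v : nnm u -> nnm v ->
  \int[mu]_x (u x + v x)%:E = \int[mu]_x (u x)%:E + \int[mu]_x (v x)%:E.
Proof.
move=> nu nv; under eq_integral do rewrite EFinD.
apply: ge0_integralD => //.
- by move=> x _; rewrite lee_fin; exact: nu.2.
- exact: emeas.
- by move=> x _; rewrite lee_fin; exact: nv.2.
- exact: emeas.
Qed.

Lemma intZ (c : R) u : (0 <= c)%R -> nnm u ->
  \int[mu]_x (c * u x)%:E = c%:E * \int[mu]_x (u x)%:E.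
Proof.
move=> c0 nu; under eq_integral do rewrite EFinM.
apply: ge0_integralZl_EFin => //.
- by move=> x _; rewrite lee_fin; exact: nu.2.
- exact: emeas.
Qed.

Lemma int_sum (I : Type) (s : seq I) (u : I -> T -> R) :
  (forall i, nnm (u i)) ->
  \int[mu]_x (\sum_(i <- s) u i x)%:E = \sum_(i <- s) \int[mu]_x (u i x)%:E.
Proof.
move=> nu; under eq_integral do rewrite -sumEFin.
apply: ge0_integral_sum => // i.
- by apply: emeas; exact: nu.
- by move=> x _; rewrite lee_fin; exact: (nu i).2.
Qed.

Lemma int_indic (E : set T) u : measurable E ->
  \int[mu]_(x in E) (u x)%:E = \int[mu]_x (\1_E x * u x)%:E.
Proof.
move=> mE; rewrite integral_mkcond; apply: eq_integral => x _.
by rewrite patchE indicE; case: (x \in E); rewrite ?mul1r ?mul0r.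
Qed.

(** Monotone convergence in the form used throughout: an upper bound on the
integrals passes to an increasing limit. *)
Lemma le_int_lim (w : nat -> T -> R) u (c : \bar R) :
  (forall n, nnm (w n)) ->
  (forall x n m, (n <= m)%N -> (w n x <= w m x)%R) ->
  (forall x, w n x @[n --> \oo] --> u x) ->
  (forall n, \int[mu]_x (w n x)%:E <= c) ->
  \int[mu]_x (u x)%:E <= c.
Proof.
move=> nw ndw wu wc.
have -> : \int[mu]_x (u x)%:E = limn (fun n => \int[mu]_x (w n x)%:E).
  rewrite -monotone_convergence//.
  - apply: eq_integral => x _; apply/esym/cvg_lim => //.
    by apply: cvg_EFin; [exact: nearW|exact: wu].
  - by move=> n; apply: emeas.
  - by move=> n x _; rewrite lee_fin; exact: (nw n).2.
  - by move=> x _ n m nm; rewrite lee_fin ndw.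
apply: lime_le; last exact: nearW.
apply: ereal_nondecreasing_is_cvgn => n m nm.
by apply: le_int => // x; exact: ndw.
Qed.

Lemma le_int_exhaustion (Om : nat -> set T) u (c : \bar R) : nnm u ->
  (forall k, measurable (Om k)) ->
  (forall k l, (k <= l)%N -> Om k `<=` Om l) -> [set: T] = \bigcup_k Om k ->
  (forall k, \int[mu]_x (\1_(Om k) x * u x)%:E <= c) ->
  \int[mu]_x (u x)%:E <= c.
Proof.
move=> nu mOm ndOm OmT; apply: le_int_lim.
- by move=> k; apply: nnm_mul => //; exact: nnm_indic.
- move=> x k l kl; apply: ler_wpM2r; first exact: nu.2.
  rewrite !indicE; have [xk|_] := boolP (x \in Om k); last by rewrite ler0n.
  by rewrite (mem_set (ndOm k l kl x (set_mem xk))).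
- move=> x; have [k0 _ xk0] : (\bigcup_k Om k) x by rewrite -OmT.
  apply: cvg_near_cst; exists k0 => // k /= k0k.
  by rewrite indicE (mem_set (ndOm _ _ k0k _ xk0)) mul1r.
Qed.

Lemma int0_ae u : nnm u -> \int[mu]_x (u x)%:E = 0 ->
  {ae mu, forall x, u x = 0%R}.
Proof.
move=> nu iu0.
have /(ae_eq_integral_abs _ measurableT (emeas nu)) : \int[mu]_x `|(u x)%:E| = 0.
  by rewrite -iu0; apply: eq_integral => x _; rewrite gee0_abs// lee_fin nu.2.
by apply: filterS => x /(_ I) /= [].
Qed.

Lemma eq_int_ae u v : nnm u -> nnm v -> {ae mu, forall x, u x = v x} ->
  \int[mu]_x (u x)%:E = \int[mu]_x (v x)%:E.
Proof.
move=> nu nv uv; apply: ge0_ae_eq_integral => //.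
- exact: emeas.
- exact: emeas.
- by move=> x _; rewrite lee_fin nu.2.
- by move=> x _; rewrite lee_fin nv.2.
- by move: uv; apply: filterS => x /= -> _.
Qed.

End nonnegative_integral.

Section superadditivity.
Context {R : realType}.

Lemma powR_superadd (r x y : R) : (1 <= r)%R -> (0 <= x)%R -> (0 <= y)%R ->
  (x `^ r + y `^ r <= (x + y) `^ r)%R.
Proof.
move=> r1 x0 y0; have r0 : (0 < r)%R by exact: lt_le_trans r1.
have r10 : (0 <= r - 1)%R by rewrite subr_ge0.
rewrite -(mulr_powRB1 x0 r0) -(mulr_powRB1 y0 r0) -(mulr_powRB1 (addr_ge0 x0 y0) r0).
rewrite mulrDl; apply: lerD; apply: ler_wpM2l => //; apply: ge0_ler_powR => //;
  by rewrite ?nnegrE ?addr_ge0 ?lerDl ?lerDr.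
Qed.

Lemma poweR_superadd (r : R) (x y : \bar R) : (1 <= r)%R -> 0 <= x -> 0 <= y ->
  x `^ r + y `^ r <= (x + y) `^ r.
Proof.
move=> r1; have r0 : (r != 0)%R by rewrite gt_eqF// (lt_le_trans _ r1).
case: x => [x| |]//; case: y => [y| |]//; rewrite ?lee_fin => x0 y0.
- exact: powR_superadd.
- by rewrite addey// poweRyr// leey.
- by rewrite addye// poweRyr// leey.
- by rewrite addye// poweRyr// leey.
Qed.

(** This is where p <= q enters: it is used with the exponent r = q / p. *)
Lemma poweR_superadd_sum (I : Type) (s : seq I) (r : R) (z : I -> \bar R) :
  (1 <= r)%R -> (forall i, 0 <= z i) ->
  \sum_(i <- s) z i `^ r <= (\sum_(i <- s) z i) `^ r.
Proof.
move=> r1 z0; elim: s => [|i s ih]; first by rewrite !big_nil poweR_ge0.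
rewrite !big_cons; apply: le_trans (poweR_superadd r1 _ _) => //.
  by rewrite leeD2l.
exact: sume_ge0.
Qed.

Lemma le_poweR (r : R) (x y : \bar R) : (0 <= r)%R -> 0 <= x -> x <= y ->
  x `^ r <= y `^ r.
Proof.
move=> r0 x0 xy; apply: gt0_ler_poweR => //.
- by rewrite in_itv/= x0 leey.
- by rewrite in_itv/= (le_trans x0 xy) leey.
Qed.

End superadditivity.

(** * From sets to functions on a sub-sigma-algebra *)
Import HBNNSimple.

(** Approximation from below avoids the discontinuity at 0 of [powR] as a
function on the whole line, where it takes the value 1 at negative arguments. *)
Lemma cvg_powR_below (R : realType) (r : R) (w : nat -> R) (l : R) :
  (0 < r)%R -> (forall n, (0 <= w n <= l)%R) ->
  w @ \oo --> l -> (w n `^ r)%R @[n --> \oo] --> (l `^ r)%R.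
Proof.
move=> r0 wl cw; have l0 : (0 <= l)%R.
  by have /andP[] := wl 0%N; exact: le_trans.
have [l_eq0|l_neq0] := eqVneq l 0%R.
  rewrite (_ : (fun n => _) = cst (l `^ r)%R); first exact: cvg_cst.
  apply/funext => n /=; congr (_ `^ _)%R.
  by apply/eqP; rewrite eq_le; have := wl n; rewrite l_eq0 andbC.
have l_gt0 : (0 < l)%R by rewrite lt_neqAle eq_sym l_neq0.
apply: (@continuous_cvg _ _ _ _ _ _ (fun y => y `^ r)%R) => //.
apply: differentiable_continuous; apply/derivable1_diffP.
by have [] := is_derive1_powR r l_gt0.
Qed.

Section sub_sigma_algebra.
Context {d : measure_display} {T : measurableType d} {R : realType}.
Variable mu : {measure set T -> \bar R}.
Variable G : set (set T).
Hypothesis Gm : G `<=` measurable.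

Definition nnm_wrt (h : T -> R) := @nnm _ (g_sigma_algebraType G) R h.

Lemma measurable_sub (E : set T) : G.-sigma.-measurable E -> measurable E.
Proof. by move: E; exact: smallest_sub (@sigma_algebra_measurable _ T) Gm. Qed.

Lemma measurable_wrt_sub (h : T -> R) :
  measurable_wrt G h -> measurable_fun [set: T] h.
Proof.
move=> mh _ Y mY.
by rewrite setTI; apply: measurable_sub; rewrite -[X in measurable X]setTI; exact: mh.
Qed.

Lemma nnm_sub h : nnm_wrt h -> @nnm _ T R h.
Proof. by move=> [mh h0]; split=> //; exact: measurable_wrt_sub. Qed.

(** [k] is the power with which the simple function enters the integral; it is
assumed nonnegative everywhere in order that the terms of the sum be so. *)
Lemma int_simple (s : {nnsfun (g_sigma_algebraType G) >-> R}) (k : R -> R)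
    (u : T -> R) : (forall y, (0 <= k y)%R) -> nnm u ->
  \int[mu]_x (k (s x) * u x)%:E =
  \sum_(y <- fset_set (range s))
     (k y)%:E * \int[mu]_(x in s @^-1` [set y]) (u x)%:E.
Proof.
move=> k0 nu.
have mA y : measurable (s @^-1` [set y] : set T).
  by apply: measurable_sub; exact: measurable_sfunP.
have nA y : nnm (fun x : T => \1_(s @^-1` [set y] : set T) x * u x : R)%R.
  by apply: nnm_mul => //; exact: nnm_indic.
transitivity (\int[mu]_x (\sum_(y <- fset_set (range s))
    k y * (\1_(s @^-1` [set y] : set T) x * u x))%:E).
  apply: eq_integral => x _; congr EFin.
  have sx : s x \in fset_set (range s).
    by rewrite in_fset_set// inE; exists x.
  rewrite (bigD1_seq (s x))//=; last exact: fset_uniq.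
  rewrite big1 ?addr0.
    by rewrite indicE mem_set// mul1r.
  move=> y ysx; rewrite indicE memNset ?mul0r ?mulr0//.
  by move=> /= sxy; rewrite sxy eqxx in ysx.
rewrite int_sum; last first.
  by move=> y; apply: nnm_mul => //; exact: nnm_cst.
apply: eq_bigr => y _; rewrite intZ//; congr (_ * _).
by rewrite [RHS]int_indic.
Qed.

(** For a simple function, the integral on the left is the sum over its values y
of y^r times an integral over a level set; the hypothesis applies to each level
set, and r >= 1 lets the sum enter the r-th power.  The general case follows by
monotone approximation.  The case r = c = 1 says that comparison of two
measures on sets implies comparison on functions. *)
Lemma le_int_gauge (u v : T -> R) (r c : R) :
  nnm u -> nnm v -> (1 <= r)%R -> (0 <= c)%R ->
  (forall E, G.-sigma.-measurable E ->
    \int[mu]_(x in E) (u x)%:E <= c%:E * (\int[mu]_(x in E) (v x)%:E) `^ r) ->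
  forall h, nnm_wrt h ->
    \int[mu]_x (h x `^ r * u x)%:E <= c%:E * (\int[mu]_x (h x * v x)%:E) `^ r.
Proof.
move=> nu nv r1 c0 uv h nh; have r0 : (0 < r)%R by exact: lt_le_trans r1.
have mh : measurable_fun [set: g_sigma_algebraType G] (EFin \o h).
  by apply/measurable_EFinP; exact: nh.1.
pose s := nnsfun_approx measurableT mh.
have ns n : nnm_wrt (s n).
  by split => //; exact: measurable_funPT.
have sn_h x : s ^~ x @ \oo --> h x.
  have h0 y : [set: g_sigma_algebraType G] y -> 0%R <= (EFin \o h) y.
    by move=> _; rewrite lee_fin nh.2.
  by have /fine_cvgP[_] := cvg_nnsfun_approx measurableT mh h0 (x := x) I.
have nds x n m : (n <= m)%N -> (s n x <= s m x)%R.
  by move=> nm; exact/lefP/nd_nnsfun_approx.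
have slh n x : (s n x <= h x)%R.
  rewrite -(cvg_lim _ (sn_h x))//.
  by apply: nondecreasing_cvgn_le; [exact: nds|exact: cvgP (sn_h x)].
apply: (@le_int_lim _ T _ mu (fun n (x : T) => s n x `^ r * u x)%R).
- move=> n; apply: nnm_mul => //; apply: nnm_powR; exact/nnm_sub.
- move=> x n m nm; apply: ler_wpM2r; first exact: nu.2.
  by apply: ge0_ler_powR; rewrite ?nnegrE ?nds// ltW.
- move=> x; apply: cvgMr_tmp; apply: cvg_powR_below => // n.
  by rewrite slh andbT; exact: (ns n).2.
move=> n; rewrite (int_simple _ (fun y => powR_ge0 y r))//.
apply: (@le_trans _ _ (c%:E * (\int[mu]_x (s n x * v x)%:E) `^ r)); last first.
  apply: lee_wpmul2l => //; apply: le_poweR; first exact: ltW.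
    by apply: int_ge0; apply: nnm_mul => //; exact/nnm_sub.
  apply: le_int.
  - by apply: nnm_mul => //; exact/nnm_sub.
  - by apply: nnm_mul => //; exact/nnm_sub.
  - by move=> x; apply: ler_wpM2r => //; exact: nv.2.
rewrite (_ : \int[mu]_x (s n x * v x)%:E =
    \int[mu]_x (Num.max (s n x) 0 * v x)%:E); last first.
  by apply: eq_integral => x _; rewrite max_l.
rewrite (@int_simple (s n) (Num.max^~ 0%R))//; last first.
  by move=> y; rewrite le_max lexx orbT.
set S := fset_set _.
apply: (@le_trans _ _ (\sum_(y <- S)
    c%:E * ((Num.max y 0)%:E * \int[mu]_(x in s n @^-1` [set y]) (v x)%:E) `^ r)).
  rewrite big_seq [leRHS]big_seq; apply: lee_sum => y.
  rewrite in_fset_set// inE => -[x _ <-].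
  rewrite max_l; last exact: (ns n).2.
  rewrite poweRM; last first.
  - by apply: integral_ge0 => z _; rewrite lee_fin nv.2.
  - by rewrite lee_fin; exact: (ns n).2.
  rewrite poweR_EFin muleCA; apply: lee_wpmul2l; first by rewrite lee_fin powR_ge0.
  by apply: uv; exact: measurable_sfunP.
rewrite -ge0_sume_distrr//; last by move=> y; rewrite poweR_ge0.
apply: lee_wpmul2l => //; apply: poweR_superadd_sum => // y.
apply: mule_ge0; first by rewrite lee_fin le_max lexx orbT.
by apply: integral_ge0 => z _; rewrite lee_fin nv.2.
Qed.

End sub_sigma_algebra.

(** * Densities with respect to the trace of the measure on a sub-sigma-algebra *)
Section trace.
Context {d : measure_display} {T : measurableType d} {R : realType}.
Variable mu : {measure set T -> \bar R}.
Variable G : set (set T).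
Hypothesis Gm : G `<=` measurable.

Let gT := g_sigma_algebraType G.

Lemma measurable_fun_inclusion : measurable_fun [set: T] (id : T -> gT).
Proof. by move=> _ Y mY; rewrite setTI; exact: (measurable_sub Gm mY). Qed.

Hypothesis sfG : sigma_finite [set: gT] (mu : set gT -> \bar R).

(** [mu] itself, seen on the smaller sigma-algebra; the two arguments carry the
proofs from which the measure structure is inferred. *)
Definition trace_measure & G `<=` measurable
    & sigma_finite [set: gT] (mu : set gT -> \bar R) : set gT -> \bar R := mu.

Local Notation muG := (trace_measure Gm sfG).

Let muG0 : muG set0 = 0. Proof. exact: measure0. Qed.

Let muG_ge0 E : 0 <= muG E. Proof. exact: measure_ge0. Qed.

Let muG_sigma_additive : semi_sigma_additive muG.
Proof.
move=> A mA tA mUA; apply: (@measure_semi_sigma_additive _ _ _ mu) => //.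
- by move=> n; exact: (measurable_sub Gm (mA n)).
- exact: (measurable_sub Gm mUA).
Qed.

HB.instance Definition _ := isMeasure.Build _ _ _ muG muG0 muG_ge0 muG_sigma_additive.

HB.instance Definition _ := Measure_isSigmaFinite.Build _ _ _ muG sfG.

(** Change of variables along the identity map from [T] to [gT]. *)
Lemma int_trace (h : T -> R) (E : set T) : nnm_wrt G h -> G.-sigma.-measurable E ->
  \int[muG]_(x in E) (h x)%:E = \int[mu]_(x in E) (h x)%:E.
Proof.
move=> nh mE.
transitivity (\int[mu]_(x in (id : T -> gT) @^-1` E) ((EFin \o h) \o (id : T -> gT)) x);
  last by [].
rewrite -(ge0_integral_pushforward measurable_fun_inclusion)//.
- by apply: measurable_funTS; apply/measurable_EFinP; exact: nh.1.
- by move=> x _; rewrite lee_fin; exact: nh.2.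
Qed.

Section density.
Variables (u : T -> R) (nu : nnm u).
Hypothesis ufin : \int[mu]_x (u x)%:E < +oo.

(** The measure with density [u], on the smaller sigma-algebra, for which [u]
need not be measurable; the arguments carry the proofs from which the finite
measure structure is inferred. *)
Definition density_measure & nnm u & \int[mu]_x (u x)%:E < +oo :
    set gT -> \bar R :=
  fun E => \int[mu]_(x in E) (u x)%:E.

Local Notation nu_ := (density_measure nu ufin).

Let nu0 : nu_ set0 = 0.
Proof. by rewrite /density_measure integral_set0. Qed.

Let nu_ge0 E : 0 <= nu_ E.
Proof. by apply: integral_ge0 => x _; rewrite lee_fin nu.2. Qed.

Let nu_sigma_additive : semi_sigma_additive nu_.
Proof.
move=> A mA tA mUA.
apply: (@semi_sigma_additive_nng_induced _ T _ mu (EFin \o u)) => //.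
- by apply/measurable_EFinP; exact: nu.1.
- by move=> x; rewrite lee_fin nu.2.
- by move=> n; exact: (measurable_sub Gm (mA n)).
- exact: (measurable_sub Gm mUA).
Qed.

HB.instance Definition _ := isMeasure.Build _ _ _ nu_ nu0 nu_ge0 nu_sigma_additive.

Let nu_fin : fin_num_fun nu_.
Proof.
move=> E mE; have mE' := measurable_sub Gm mE.
rewrite ge0_fin_numE//; apply: le_lt_trans ufin.
rewrite /density_measure int_indic//; apply: le_int => //.
  by apply: nnm_mul => //; exact: nnm_indic.
by move=> x; apply: ler_piMl; [exact: nu.2|rewrite indicE lern1 leq_b1].
Qed.

HB.instance Definition _ := Measure_isFinite.Build _ _ _ nu_ nu_fin.

Lemma density_radon_nikodym :
  exists2 s, nnm_wrt G s & forall E, G.-sigma.-measurable E ->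
    \int[mu]_(x in E) (u x)%:E = \int[mu]_(x in E) (s x)%:E.
Proof.
have numu : nu_ `<< muG.
  apply/null_content_dominatesP => /= E mE muE.
  have mE' := measurable_sub Gm mE.
  apply: null_set_integral => //.
  by apply: measurable_funTS; apply/measurable_EFinP; exact: nu.1.
pose f := Radon_Nikodym_SigmaFinite.f nu_ muG.
have ff x : f x \is a fin_num by exact: Radon_Nikodym_SigmaFinite.f_fin_num.
have fE : f = EFin \o (fine \o f) by apply/funext => x /=; rewrite fineK.
have ns : nnm_wrt G (fine \o f).
  split=> [|x]; last first.
    by apply: fine_ge0; exact: Radon_Nikodym_SigmaFinite.f_ge0.
  apply/measurable_EFinP; rewrite -fE.
  exact: measurable_int (Radon_Nikodym_SigmaFinite.f_integrable numu).
exists (fine \o f) => // E mE.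
rewrite -(int_trace ns mE).
apply: etrans (Radon_Nikodym_SigmaFinite.f_integral numu mE) _.
by apply: eq_integral => x _; rewrite /= fineK.
Qed.

End density.
End trace.

(** * Conditional versions of nonnegative functions *)
Section cond_version.
Context {d : measure_display} {T : measurableType d} {R : realType}.
Variable mu : {measure set T -> \bar R}.
Variable G : set (set T).
Hypothesis Gm : G `<=` measurable.

Let gT := g_sigma_algebraType G.

(** Conditional expectation tested against functions rather than sets: for
nonnegative functions this identity makes sense without any integrability, and
it is the only property of conditional expectations that the estimates use. *)
Definition cond_version (k s : T -> R) :=
  nnm_wrt G s /\ forall h, nnm_wrt G h ->
    \int[mu]_x (h x * k x)%:E = \int[mu]_x (h x * s x)%:E.

Lemma cond_version_sets (k s : T -> R) : nnm k -> nnm_wrt G s ->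
  (forall E, G.-sigma.-measurable E ->
    \int[mu]_(x in E) (k x)%:E = \int[mu]_(x in E) (s x)%:E) ->
  cond_version k s.
Proof.
move=> nk ns ks; split=> // h nh; have ns' := nnm_sub Gm ns.
have half u v : nnm u -> nnm v -> (forall E, G.-sigma.-measurable E ->
    \int[mu]_(x in E) (u x)%:E = \int[mu]_(x in E) (v x)%:E) ->
    \int[mu]_x (h x * u x)%:E <= \int[mu]_x (h x * v x)%:E.
  move=> nu nv uv.
  have : \int[mu]_x (h x `^ 1 * u x)%:E <=
      1%:E * (\int[mu]_x (h x * v x)%:E) `^ 1.
    apply: (le_int_gauge Gm) => // E mE; rewrite mul1e uv// poweRe1//.
    by apply: integral_ge0 => x _; rewrite lee_fin nv.2.
  rewrite mul1e poweRe1; last first.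
    by apply: int_ge0; apply: nnm_mul => //; exact: nnm_sub nh.
  by under eq_integral do rewrite powRr1 ?(nh.2)//.
by apply/eqP; rewrite eq_le !half// => E mE; rewrite ks.
Qed.

Lemma integral_partition (D : nat -> set T) (E : set T) (u : T -> R) :
  nnm u -> (forall n, measurable (D n)) -> trivIset setT D ->
  [set: T] = \bigcup_n D n -> measurable E ->
  \int[mu]_(x in E) (u x)%:E = \sum_(n <oo) \int[mu]_(x in E `&` D n) (u x)%:E.
Proof.
move=> nu mD tD DT mE; rewrite -{1}(setIT E) DT setI_bigcupr.
rewrite ge0_integral_bigcup//.
- by move=> n; exact: measurableI.
- by apply: measurable_funTS; apply/measurable_EFinP; exact: nu.1.
- by move=> x _; rewrite lee_fin nu.2.
- exact: trivIset_setIl.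
Qed.

Lemma sigma_finite_partition : sigma_finite [set: gT] (mu : set gT -> \bar R) ->
  exists D : nat -> set T, [/\ (forall n, G.-sigma.-measurable (D n)),
    trivIset setT D, [set: T] = \bigcup_n D n & forall n, mu (D n) < +oo].
Proof.
move=> [A AT Afin]; exists (seqDU A).
have mA n : G.-sigma.-measurable (A n) by exact: (Afin n).1.
have mD n : G.-sigma.-measurable (seqDU A n : set gT).
  by apply: measurableD => //; exact: bigsetU_measurable.
split => //.
- by rewrite -seqDU_bigcup_eq.
- move=> n; apply: le_lt_trans (Afin n).2.
  apply: le_measure; rewrite ?inE.
  + exact: (measurable_sub Gm (mD n)).
  + exact: (measurable_sub Gm (mA n)).
  + exact: subDsetl.
Qed.

(** The densities provided by the Radon-Nikodym theorem on the pieces of a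
partition into sets of finite measure are glued together. *)
Lemma cond_version_exists (k : T -> R) :
  sigma_finite [set: gT] (mu : set gT -> \bar R) -> nnm k ->
  (forall E, G.-sigma.-measurable E -> mu E < +oo ->
    \int[mu]_(x in E) (k x)%:E < +oo) ->
  exists s, cond_version k s.
Proof.
move=> sfG nk kfin.
have [D [mD tD DT Dfin]] := sigma_finite_partition sfG.
have mD' n := measurable_sub Gm (mD n).
have nkD n : nnm (fun x => \1_(D n) x * k x)%R.
  by apply: nnm_mul => //; exact: nnm_indic.
have ikD n : \int[mu]_x (\1_(D n) x * k x)%:E < +oo by rewrite -int_indic// kfin.
have /choice[s0 s0P] n : exists s, nnm_wrt G s /\ forall E, G.-sigma.-measurable E ->
    \int[mu]_(x in E) (\1_(D n) x * k x)%:E = \int[mu]_(x in E) (s x)%:E.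
  by have [s ? ?] := density_radon_nikodym Gm sfG (nkD n) (ikD n); exists s.
pose t n (x : gT) : \bar R := (\1_(D n : set gT) x * s0 n x)%:E.
have t0 n x : 0 <= t n x.
  by rewrite lee_fin; apply: mulr_ge0; [rewrite indicE|exact: (s0P n).1.2].
pose s (x : gT) := fine (\sum_(n <oo) t n x).
have sD n x : D n x -> s x = s0 n x.
  move=> Dnx; rewrite /s.
  have := @nneseriesD1 _ (t ^~ x) n xpredT (fun k _ => t0 k x) isT.
  move=> /= ->; rewrite eseries0 ?adde0.
    by rewrite /t indicE mem_set// mul1r.
  move=> m _ /= mn; rewrite /t indicE memNset ?mul0r// => Dmx.
  have /eqP := tD m n I I (ex_intro _ x (conj Dmx Dnx)).
  by rewrite (negbTE mn).
have ns : nnm_wrt G s.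
  split=> [|x]; last by apply: fine_ge0; apply: nneseries_ge0 => n _ _; exact: t0.
  apply: (@measurableT_comp _ _ _ _ _ _ (fine : \bar R -> R)) => /=; first exact: fine_measurable.
  apply: ge0_emeasurable_sum => [n x _ _|n _]; first exact: t0.
  apply/measurable_EFinP; apply: (nnm_mul _ (s0P n).1).1.
  by apply: nnm_indic; exact: mD.
exists s; apply: cond_version_sets => // E mE.
have mE' := measurable_sub Gm mE.
rewrite (@integral_partition D)// (@integral_partition D _ s)//; last first.
  exact: (nnm_sub Gm ns).
apply: eq_eseriesr => n _.
have mED : G.-sigma.-measurable (E `&` D n : set gT) by exact: measurableI.
transitivity (\int[mu]_(x in E `&` D n) (\1_(D n) x * k x)%:E).
  by apply: eq_integral => x; rewrite inE => -[_ Dx]; rewrite indicE mem_set// mul1r.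
rewrite (s0P n).2//; apply: eq_integral => x; rewrite inE => -[_ Dx].
by rewrite (sD n).
Qed.

End cond_version.

(** * Conditional expectations along the filtration *)
Section cond_version_unique.
Context {d : measure_display} {T : measurableType d} {R : realType}.
Variable mu : {measure set T -> \bar R}.
Variable G : set (set T).
Hypothesis Gm : G `<=` measurable.

Let gT := g_sigma_algebraType G.
Hypothesis sfG : sigma_finite [set: gT] (mu : set gT -> \bar R).

(** Needed for the function chosen as conditional expectation, of which only
almost everywhere nonnegativity is known. *)
Lemma int_trace_signed (c : T -> R) (E : set T) : measurable_wrt G c ->
  G.-sigma.-measurable E ->
  \int[trace_measure Gm sfG]_(x in E) (c x)%:E = \int[mu]_(x in E) (c x)%:E.
Proof.
move=> mc mE.
have np : nnm_wrt G (fun x => Num.max (c x) 0)%R.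
  split=> [|x]; last by rewrite le_max lexx orbT.
  by apply: measurable_maxr => //; exact: measurable_cst.
have nn : nnm_wrt G (fun x => Num.max (- c x) 0)%R.
  split=> [|x]; last by rewrite le_max lexx orbT.
  apply: measurable_maxr; last exact: measurable_cst.
  exact: measurableT_comp.
rewrite [LHS]integralE [RHS]integralE; congr (_ - _).
- rewrite (eq_integral (fun x : gT => (Num.max (c x) 0)%:E)); last first.
    by move=> x _; rewrite funeposE EFin_max.
  rewrite int_trace//; apply: eq_integral => x _.
  by rewrite funeposE EFin_max.
- rewrite (eq_integral (fun x : gT => (Num.max (- c x) 0)%:E)); last first.
    by move=> x _; rewrite funenegE EFin_max.
  rewrite int_trace//; apply: eq_integral => x _.
  by rewrite funenegE EFin_max.
Qed.

Lemma cond_version_unique (c s : T -> R) : measurable_wrt G c -> nnm_wrt G s ->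
  (forall E, G.-sigma.-measurable E -> mu E < +oo ->
    \int[mu]_(x in E) (s x)%:E < +oo) ->
  (forall E, G.-sigma.-measurable E -> mu E < +oo ->
    \int[mu]_(x in E) (c x)%:E = \int[mu]_(x in E) (s x)%:E) ->
  {ae mu, forall x, c x = s x}.
Proof.
move=> mc ns sfin cs.
have [D [mD tD DT Dfin]] := sigma_finite_partition Gm sfG.
have Dn n : {ae mu, forall x, D n x -> c x = s x}.
  have [N [mN N0 sN]] : ae_eq (trace_measure Gm sfG) (D n : set gT)
      (EFin \o s) (EFin \o c).
    apply: integral_ae_eq => //.
    - apply/integrableP; split.
        by apply: measurable_funTS; apply/measurable_EFinP; exact: ns.1.
      rewrite (eq_integral (fun x : gT => (s x)%:E)); last first.
        by move=> x _; rewrite /= ger0_norm// ns.2.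
      by rewrite int_trace// sfin.
    - by apply: measurable_funTS; apply/measurable_EFinP; exact: mc.
    - move=> E ED mE; rewrite (int_trace Gm sfG ns mE) (int_trace_signed mc mE).
      rewrite cs//; apply: le_lt_trans (Dfin n); apply: le_measure => //;
        rewrite inE; exact: (measurable_sub Gm).
  exists N; split => //; first exact: (measurable_sub Gm mN).
  move=> x /= /not_implyP[Dx csx]; apply: sN => /= /(_ Dx)[sc].
  by apply: csx; rewrite sc.
have := ae_foralln Dn; apply: filterS => x csx.
have [n _ Dx] : (\bigcup_n D n) x by rewrite -DT.
exact: csx Dx.
Qed.

End cond_version_unique.

Section conditional_expectation.
Context {d : measure_display} {T : measurableType d} {R : realType}.
Variable mu : {sigma_finite_measure set T -> \bar R}.
Variable F : int -> set (set T).
Hypothesis filtF : sigma_finite_filtration mu F.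

Lemma filtration_sub i : F i `<=` measurable.
Proof. by move=> A; apply (filtration_measurable filtF). Qed.

Lemma filtration_sigmaE i : (F i).-sigma.-measurable = F i.
Proof. exact: measurable_g_measurableTypeE (filtration_sigma_algebra filtF i). Qed.

(** The chosen conditional expectation of a weight may be negative on a
negligible set, which would spoil the pointwise estimates. *)
Definition nonneg_cond_exp i (k : T -> R) : T -> R :=
  fun x => Num.max (cond_exp mu F i k x) 0%R.

Lemma weight_nnm (k : T -> R) : weight mu F k -> nnm k.
Proof. by move=> [[]]. Qed.

Lemma int_lty (k : T -> R) i E : weight mu F k ->
  F i E -> mu E < +oo -> \int[mu]_(x in E) (k x)%:E < +oo.
Proof.
move=> [[_ ki] k0] FE Efin; have /integrableP[_] := ki i E (conj FE Efin).
by under eq_integral do rewrite gee0_abs ?lee_fin ?k0//.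
Qed.

Lemma cond_exp_ae (k : T -> R) i : weight mu F k ->
  measurable_wrt (F i) (cond_exp mu F i k) /\
  exists s, cond_version mu (F i) k s /\
    {ae mu, forall x, cond_exp mu F i k x = s x}.
Proof.
move=> wk; have nk := weight_nnm wk; have sf := filtration_sigma_finite filtF i.
have kfin E : (F i).-sigma.-measurable E -> mu E < +oo ->
    \int[mu]_(x in E) (k x)%:E < +oo.
  by rewrite filtration_sigmaE; exact: int_lty.
have [s vs] := cond_version_exists (@filtration_sub i) sf nk kfin.
have ks E : (F i).-sigma.-measurable E ->
    \int[mu]_(x in E) (k x)%:E = \int[mu]_(x in E) (s x)%:E.
  move=> mE; have mE' := measurable_sub (@filtration_sub i) mE.
  rewrite [LHS]int_indic// [RHS]int_indic//.
  by apply: vs.2; exact: nnm_indic.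
have ms : measurable_fun setT s by exact: (nnm_sub (@filtration_sub i) vs.1).1.
have [mc _ ck] : is_cond_exp mu F i k (cond_exp mu F i k).
  rewrite /cond_exp; apply: xgetPex; exists s; split.
  - exact: vs.1.1.
  - move=> E [FE Efin]; rewrite -filtration_sigmaE in FE.
    apply/integrableP; split.
      by apply: measurable_funTS; apply/measurable_EFinP.
    under eq_integral do rewrite gee0_abs ?lee_fin ?vs.1.2//.
    by rewrite -ks// kfin.
  - by move=> E [FE Efin]; rewrite ks// filtration_sigmaE.
split => //; exists s; split => //.
apply: (cond_version_unique (@filtration_sub i) sf) => //; first exact: vs.1.
- by move=> E mE Efin; rewrite -ks// kfin.
- by move=> E mE Efin; rewrite -ks//; apply: ck; split=> //; rewrite -filtration_sigmaE.
Qed.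

Lemma cond_exp_eq_nonneg (k : T -> R) i : weight mu F k ->
  {ae mu, forall x, cond_exp mu F i k x = nonneg_cond_exp i k x}.
Proof.
move=> wk; have [_ [s [[ns _] +]]] := cond_exp_ae i wk.
by apply: filterS => x cs; rewrite /nonneg_cond_exp max_l// cs ns.2.
Qed.

Lemma nonneg_cond_expP (k : T -> R) i : weight mu F k ->
  cond_version mu (F i) k (nonneg_cond_exp i k).
Proof.
move=> wk; have [mc [s [vs cs]]] := cond_exp_ae i wk.
have nc : nnm_wrt (F i) (nonneg_cond_exp i k).
  split=> [|x]; last by rewrite le_max lexx orbT.
  apply: measurable_maxr; last exact: measurable_cst.
  exact: mc.
split=> // h nh; rewrite vs.2//; apply: eq_int_ae.
- by apply: nnm_mul; [exact: (nnm_sub (@filtration_sub i) nh)|exact: (nnm_sub (@filtration_sub i) vs.1)].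
- by apply: nnm_mul; [exact: (nnm_sub (@filtration_sub i) nh)|exact: (nnm_sub (@filtration_sub i) nc)].
- move: cs (cond_exp_eq_nonneg i wk); apply: filterS2 => x cs cn.
  by rewrite -cs cn.
Qed.

End conditional_expectation.

Arguments filtration_sub {d T R mu F} filtF i _ _.

(** * Young's inequality and stages of a nonnegative sequence *)
Section real_lemmas.
Context {R : realType}.
Local Open Scope ring_scope.

Lemma le_powR (r x y : R) : 0 <= r -> 0 <= x -> x <= y -> x `^ r <= y `^ r.
Proof.
move=> r0 x0 xy; apply: ge0_ler_powR => //; rewrite nnegrE//.
exact: le_trans xy.
Qed.

Lemma conjugate_gt1 (q r : R) : 1 < q -> q^-1 + r^-1 = 1 -> 1 < r.
Proof.
move=> q1 qr; have q0 : 0 < q by exact: lt_trans q1.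
have rE : r^-1 = 1 - q^-1 by rewrite -qr addrAC subrr add0r.
have q1' : q^-1 < 1 by rewrite invf_lt1.
have r0 : 0 < r by rewrite -invr_gt0 rE subr_gt0.
by rewrite -[r]invrK invf_gt1 ?invr_gt0// rE ltrBlDr ltrDl invr_gt0.
Qed.

(** The parameter [t] trades one power for the other; it is fixed at the very
end by [young_optimize]. *)
Lemma young_weighted (q r a b t : R) : 1 < q -> q^-1 + r^-1 = 1 ->
  0 <= a -> 0 <= b -> 0 < t -> a * b <= (t * a) `^ q + (b / t) `^ r.
Proof.
move=> q1 qr a0 b0 t0; have r1 := conjugate_gt1 q1 qr.
have q0 : 0 < q by exact: lt_trans q1.
have r0 : 0 < r by exact: lt_trans r1.
rewrite (_ : a * b = (t * a) * (b / t)); last by field; rewrite gt_eqF.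
apply: (le_trans (conjugate_powR _ _ q0 r0 qr)).
- by rewrite mulr_ge0// ltW.
- by rewrite divr_ge0// ltW.
apply: lerD; apply: ler_piMr; rewrite ?powR_ge0// invf_le1// ltW//.
Qed.

(** The best parameter t makes both powers equal to u b.  Replacing u and b by
u + e and b + e makes this choice legitimate also when u or b vanishes. *)
Lemma young_optimize (X : \bar R) (q r K u b : R) : 1 < q -> q^-1 + r^-1 = 1 ->
  0 <= K -> 0 <= u -> 0 <= b ->
  (forall t, 0 < t -> (X <= (K * ((t * u) `^ q + (b / t) `^ r))%:E)%E) ->
  (X <= (2 * K * u * b)%:E)%E.
Proof.
move=> q1 qr K0 u0 b0 XK; have r1 := conjugate_gt1 q1 qr.
have q0 : 0 < q by exact: lt_trans q1.
have r0 : 0 < r by exact: lt_trans r1.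
have step e : 0 < e -> (X <= (2 * K * (u + e) * (b + e))%:E)%E.
  move=> e0; set u' := u + e; set b' := b + e.
  have u'0 : 0 < u' by rewrite ltr_wpDl.
  have b'0 : 0 < b' by rewrite ltr_wpDl.
  have ub0 : 0 < u' * b' by exact: mulr_gt0.
  pose t := (u' * b') `^ q^-1 / u'.
  have w0 : 0 < (u' * b') `^ q^-1 by exact: powR_gt0.
  have t0 : 0 < t by rewrite divr_gt0.
  apply: (le_trans (XK t t0)); rewrite lee_fin.
  rewrite (_ : 2 * K * u' * b' = K * (u' * b' + u' * b')); last by ring.
  apply: ler_wpM2l => //; apply: lerD.
    have -> : u' * b' = (t * u') `^ q.
      by rewrite /t divfK ?gt_eqF// -powRrM mulVf ?gt_eqF// powRr1// ltW.
    apply: (le_powR (ltW q0) (mulr_ge0 (ltW t0) u0)).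
    by rewrite ler_pM2l// /u' lerDl ltW.
  have -> : u' * b' = (b' / t) `^ r.
    rewrite /t (_ : b' / _ = (u' * b') / (u' * b') `^ q^-1); last first.
      by field; rewrite !gt_eqF.
    rewrite -{2}[u' * b']powRr1 ?(ltW ub0)// -powRB; last first.
      by rewrite (gt_eqF ub0) implybT.
    have -> : 1 - q^-1 = r^-1 by rewrite -qr addrAC subrr add0r.
    by rewrite -powRrM mulVf ?gt_eqF// powRr1// ltW.
  apply: (le_powR (ltW r0) (divr_ge0 b0 (ltW t0))).
  by rewrite ler_pM2r ?invr_gt0// /b' lerDl ltW.
apply/lee_addgt0Pr => e e0.
pose C := 2 * K * (u + b + 1) + 1.
have C0 : 0 < C.
  rewrite ltr_wpDl// mulr_ge0//; first by rewrite mulr_ge0.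
  by rewrite !addr_ge0.
(* The bound h <= 1 turns the quadratic term in h into a linear one. *)
pose h := Num.min 1 (e / C).
have h0 : 0 < h by rewrite lt_min ltr01 divr_gt0.
apply: (le_trans (step h h0)); rewrite -EFinD lee_fin.
have h1 : h <= 1 by rewrite ge_min lexx.
have he : h * C <= e by rewrite -ler_pdivlMr// ge_min lexx orbT.
have hh : K * h * h <= K * h by rewrite ler_piMr// mulr_ge0// ltW.
by move: he hh; rewrite /C; lra.
Qed.

(** The start of the stage to which the time [n] belongs: a new stage starts when
the sequence exceeds twice its value at the start of the current one. *)
Fixpoint stage (u : nat -> R) (n : nat) : nat :=
  if n is m.+1 then if 2 * u (stage u m) < u n then n else stage u m else 0%N.

Lemma stage_le u n : (stage u n <= n)%N.
Proof. by elim: n => //= n ih; case: ifP => // _; exact: leqW. Qed.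

Lemma le_stage u n : (forall k, 0 <= u k) -> u n <= 2 * u (stage u n).
Proof.
move=> u0; have h k : u k <= 2 * u k by rewrite ler_peMl// ler1n.
by case: n => //= n; case: ltP.
Qed.

Lemma stage_between u n l : (stage u n <= l <= n)%N -> stage u l = stage u n.
Proof.
elim: n => [|n ih] /andP[sl ln]; first by move: ln; rewrite leqn0 => /eqP ->.
move: sl => /=; case: ifP => [new|old] sl.
  by rewrite (_ : l = n.+1) /= ?new//; apply/eqP; rewrite eqn_leq ln.
move: ln; rewrite leq_eqVlt => /orP[/eqP ->|]; first by rewrite /= old.
by rewrite ltnS => ln; apply: ih; rewrite sl.
Qed.

Lemma stage_idem u n : stage u (stage u n) = stage u n.
Proof. by apply: stage_between; rewrite leqnn stage_le. Qed.

(** The values at stage starts at least double, so that their powers are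
dominated by a geometric series with ratio 2^(-p) <= 1/2 ending at the last
of them. *)
Lemma sum_stage u (p : R) n : 1 <= p -> (forall k, 0 <= u k) ->
  \sum_(l < n.+1 | stage u l == l) u l `^ p <= 2 * u (stage u n) `^ p.
Proof.
move=> p1 u0; have p0 : 0 < p by exact: lt_le_trans p1.
elim: n => [|n ih].
  rewrite big_mkcond big_ord_recr big_ord0 /= add0r.
  by rewrite ler_peMl ?powR_ge0// ler1n.
rewrite big_mkcond big_ord_recr /= -big_mkcond /=.
case: (boolP (2 * u (stage u n) < u n.+1)) => [new|_].
  rewrite eqxx mulr_natl mulr2n lerD2r; apply: (le_trans ih).
  apply: (@le_trans _ _ ((2 * u (stage u n)) `^ p)).
    rewrite powRM// ler_wpM2r ?powR_ge0//.
    by rewrite -{1}[2]powRr1// ler_powR// ler1n.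
  by apply: le_powR; [exact: ltW|rewrite mulr_ge0|exact: ltW].
rewrite (_ : stage u n == n.+1 = false) ?addr0//.
by apply/negbTE; rewrite neq_ltn ltnS stage_le.
Qed.

(** If the stage of g at time n starts at l = [stage g n] no earlier than
m = [stage f n], then l lies in the stage of f beginning at m.  Hence
g n <= 2 g l is controlled by the l^r norm H m of the values of g at the stage
starts inside that stage, and each stage start of g is counted for one m
only. *)
Lemma stage_pairing (f g c : nat -> R) (N : nat) (q r t : R) :
  1 < q -> q^-1 + r^-1 = 1 -> 0 < t ->
  (forall n, 0 <= f n) -> (forall n, 0 <= g n) -> (forall n, 0 <= c n) ->
  \sum_(n < N | (stage f n <= stage g n)%N) c n * f n * g n <=
  4 * (\sum_(m < N) (t * ((stage f m == m)%:R * f m *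
                          \sum_(j < N | (m <= j)%N) c j)) `^ q +
       \sum_(l < N | stage g l == l) (g l / t) `^ r).
Proof.
move=> q1 qr t0 f0 g0 c0; have r1 := conjugate_gt1 q1 qr.
have r0 : 0 < r by exact: lt_trans r1.
pose sf (n : 'I_N) := Ordinal (leq_ltn_trans (stage_le f n) (ltn_ord n)).
(* The l^r norm of the values of g at its stage starts inside the stage of f
   beginning at m. *)
pose H (m : nat) := (\sum_(l < N | (stage g l == l) && (stage f l == m)) g l `^ r) `^ r^-1.
have H0 m : 0 <= H m by exact: powR_ge0.
pose Th (m : nat) := \sum_(j < N | (m <= j)%N) c j.
have Th0 m : 0 <= Th m by exact: sumr_ge0.
apply: (@le_trans _ _ (4 * \sum_(m < N) ((stage f m == m)%:R * f m * Th m) * H m)).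
  rewrite (partition_big sf xpredT)//= mulr_sumr; apply: ler_sum => m _.
  case: (eqVneq (stage f m) m) => [smm|smm]; last first.
    rewrite big_pred0 ?mul0r ?mulr0// => n; apply/negbTE/negP => /andP[_ /eqP sm].
    by move: smm; rewrite -sm /= stage_idem eqxx.
  rewrite mul1r.
  rewrite (_ : 4 * _ = \sum_(j < N | (m <= j)%N) 4 * (c j * f m * H m)); last first.
    by rewrite -mulr_sumr /Th [f m * _]mulrC !mulr_suml.
  rewrite big_mkcond [leRHS]big_mkcond; apply: ler_sum => n _ /=.
  case: ifPn => [/andP[sgt /eqP snm]|_]; last first.
    by case: ifP => // _; rewrite !mulr_ge0.
  have snm' : stage f n = m by rewrite -snm.
  have mn : (m <= n)%N by rewrite -snm' stage_le.
  rewrite mn.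
  have fn : f n <= 2 * f m by rewrite -snm' le_stage.
  have gn : g n <= 2 * H m.
    apply: (le_trans (le_stage n g0)); rewrite ler_pM2l//.
    pose l : 'I_N := Ordinal (leq_ltn_trans (stage_le g n) (ltn_ord n)).
    rewrite -[leLHS]powRr1// -(@mulfV _ r) ?gt_eqF// powRrM /H.
    apply: le_powR; rewrite ?powR_ge0 ?invr_ge0 ?(ltW r0)//.
    rewrite (bigD1 l)/=; last first.
      rewrite stage_idem eqxx/=; apply/eqP; rewrite -snm'.
      by apply: stage_between; rewrite sgt stage_le.
    by rewrite lerDl; apply: sumr_ge0 => *; exact: powR_ge0.
  rewrite (_ : 4 * _ = c n * (2 * f m) * (2 * H m)); last by ring.
  by rewrite ler_pM ?mulr_ge0// ler_wpM2l.
apply: ler_wpM2l => //.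
apply: (@le_trans _ _ (\sum_(m < N) ((t * ((stage f m == m)%:R * f m * Th m)) `^ q +
    (H m / t) `^ r))).
  apply: ler_sum => m _; apply: young_weighted => //.
  by rewrite !mulr_ge0.
rewrite big_split/= lerD2l.
rewrite [leRHS](partition_big sf xpredT)//=; apply: ler_sum => m _.
rewrite powRM ?invr_ge0 ?(ltW t0)// /H -powRrM mulVf ?gt_eqF// powRr1; last first.
  by apply: sumr_ge0 => *; exact: powR_ge0.
rewrite mulr_suml big_mkcond [leRHS]big_mkcond; apply: ler_sum => l _ /=.
have -> : (sf l == m) = (stage f l == m) by [].
by case: ifP => // _; rewrite powRM ?invr_ge0 ?(ltW t0).
Qed.

End real_lemmas.

(** * Doob's maximal inequality *)
Section running_maximum.
Context {R : realType}.
Local Open Scope ring_scope.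

Fixpoint run_max (u : nat -> R) (n : nat) : R :=
  if n is m.+1 then Num.max (run_max u m) (u n) else u 0%N.

Lemma run_max_ge0 u n : (forall k, 0 <= u k) -> 0 <= run_max u n.
Proof. by move=> u0; case: n => //= n; rewrite le_max u0 orbT. Qed.

Lemma run_max_ge u n l : (l <= n)%N -> u l <= run_max u n.
Proof.
elim: n => [|n ih]; first by rewrite leqn0 => /eqP ->.
rewrite leq_eqVlt => /orP[/eqP -> /=|]; first by rewrite le_max lexx orbT.
by rewrite ltnS => /ih h /=; rewrite le_max h.
Qed.

Lemma run_max_le u n B : (forall k, u k <= B) -> run_max u n <= B.
Proof. by move=> uB; elim: n => //= n ih; rewrite ge_max ih uB. Qed.

Lemma le_run_max u v n : (forall k, u k <= v k) -> run_max u n <= run_max v n.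
Proof.
by move=> uv; elim: n => //= n ih; rewrite ge_max !le_max ih uv orbT.
Qed.

Lemma eq_run_max u v n : (forall k, (k <= n)%N -> u k = v k) ->
  run_max u n = run_max v n.
Proof.
elim: n => [|n ih] uv /=; first exact: uv.
by rewrite uv// ih// => k kn; apply: uv; exact: leqW.
Qed.

Definition run_max_incr (p : R) (u : nat -> R) (n : nat) : R :=
  if n is m.+1 then run_max u n `^ (p - 1) - run_max u m `^ (p - 1)
  else u 0%N `^ (p - 1).

Lemma run_max_incr_ge0 p u n : 1 < p -> (forall k, 0 <= u k) ->
  0 <= run_max_incr p u n.
Proof.
move=> p1 u0; case: n => [|n] /=; first exact: powR_ge0.
rewrite subr_ge0; apply: le_powR; last by rewrite le_max lexx.
  by rewrite subr_ge0 ltW.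
exact: run_max_ge0.
Qed.

Lemma sum_run_max_incr p u n :
  \sum_(k < n.+1) run_max_incr p u k = run_max u n `^ (p - 1).
Proof.
elim: n => [|n ih]; first by rewrite big_ord_recr big_ord0 /= add0r.
by rewrite big_ord_recr /= ih addrC subrK.
Qed.

(** Summation by parts: an increment of [run_max u] occurs only at a time k with
run_max u k = u k <= f k, so the sum on the right dominates the sum of
y (y^(p-1) - x^(p-1)) over the successive values x < y of the running maximum;
Young's inequality for x^(p-1) y bounds each term below by
(y^p - x^p) / r. *)
Lemma doob_pathwise (p r : R) (u f : nat -> R) n : 1 < p -> p^-1 + r^-1 = 1 ->
  (forall k, 0 <= u k <= f k) ->
  r^-1 * run_max u n `^ p <= \sum_(k < n.+1) run_max_incr p u k * f k.
Proof.
move=> p1 pr uf; have r1 := conjugate_gt1 p1 pr.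
have p0 : 0 < p by exact: lt_trans p1.
have r0 : 0 < r by exact: lt_trans r1.
have u0 k : 0 <= u k by have /andP[] := uf k.
have le_uf k : u k <= f k by have /andP[] := uf k.
elim: n => [|n ih].
  rewrite big_ord_recr big_ord0 /= add0r.
  apply: (@le_trans _ _ (u 0%N `^ p)).
    by rewrite ler_piMl ?powR_ge0// invf_le1// ltW.
  by rewrite -(mulr_powRB1 (u0 0%N) p0) mulrC ler_wpM2l ?powR_ge0.
rewrite big_ord_recr /=.
have [un|un] := leP (u n.+1) (run_max u n).
  by rewrite subrr mul0r addr0.
set x := run_max u n in un ih *; set y := u n.+1 in un *.
have x0 : 0 <= x by exact: run_max_ge0.
have y0 : 0 <= y by exact: u0.
suff : r^-1 * y `^ p <= r^-1 * x `^ p + (y `^ (p - 1) - x `^ (p - 1)) * f n.+1.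
  by move=> /le_trans; apply; rewrite lerD2r.
apply: (@le_trans _ _ (r^-1 * x `^ p + (y `^ (p - 1) - x `^ (p - 1)) * y)).
  have := conjugate_powR (powR_ge0 x (p - 1)) y0 r0 p0.
  rewrite addrC => /(_ pr).
  have -> : (x `^ (p - 1)) `^ r = x `^ p.
    rewrite -powRrM; congr (_ `^ _).
    have -> : r^-1 = 1 - p^-1 -> (p - 1) * r = p.
      move=> rE; rewrite -[r]invrK rE.
      have pn1 : p - 1 != 0 by rewrite subr_eq0 gt_eqF.
      by field; rewrite gt_eqF// pn1.
    by [].
    by rewrite -pr addrAC subrr add0r.
  rewrite mulrBl [y `^ (p - 1) * y]mulrC mulr_powRB1//.
  have rE : r^-1 = 1 - p^-1 by rewrite -pr addrAC subrr add0r.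
  rewrite [x `^ p / r]mulrC [y `^ p / p]mulrC rE; lra.
rewrite lerD2l; apply: ler_wpM2l; last exact: le_uf.
by rewrite subr_ge0 le_powR// ?subr_ge0 ltW.
Qed.

End running_maximum.

Section nested_sigma_algebras.
Context {d : measure_display} {T : measurableType d} {R : realType}.

Lemma nnm_wrt_mono (G G' : set (set T)) (h : T -> R) : G `<=` G' ->
  nnm_wrt G h -> nnm_wrt G' h.
Proof.
move=> GG' [mh h0]; split=> // _ Y mY.
by apply: (sub_sigma_algebra2 GG'); exact: mh.
Qed.

Lemma nnm_run_max (G : set (set T)) (u : nat -> T -> R) n :
  (forall k, (k <= n)%N -> nnm_wrt G (u k)) ->
  nnm_wrt G (fun x => run_max (u ^~ x) n).
Proof.
elim: n => [|n ih] mu; first exact: mu.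
by apply: nnm_max; [apply: ih => k kn; apply: mu; exact: leqW|exact: mu].
Qed.

End nested_sigma_algebras.

(** The constant produced by absorbing half of the left-hand side with Young's
inequality. *)
Definition doob_constant {R : realType} (p r : R) : R :=
  (2 * r * (((2 * r)^-1 `^ r^-1)^-1) `^ p)%R.

Lemma doob_constant_ge0 {R : realType} (p r : R) : (1 < p)%R ->
  (p^-1 + r^-1 = 1)%R -> (0 <= doob_constant p r)%R.
Proof.
move=> p1 pr; have r1 := conjugate_gt1 p1 pr.
by rewrite !mulr_ge0 ?powR_ge0// (le_trans ler01)// ltW.
Qed.

Section doob.
Context {d : measure_display} {T : measurableType d} {R : realType}.
Variable mu : {measure set T -> \bar R}.
Variable G : nat -> set (set T).
Hypothesis Gm : forall n, G n `<=` measurable.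
Hypothesis Gnd : forall n m, (n <= m)%N -> G n `<=` G m.
Variables (p r : R) (w f : T -> R) (fn : nat -> T -> R).
Hypothesis p1 : (1 < p)%R.
Hypothesis pr : (p^-1 + r^-1 = 1)%R.
Hypothesis nw : nnm w.
Hypothesis wfin : \int[mu]_x (w x)%:E < +oo.
Hypothesis nf : nnm f.
Hypothesis nfn : forall n, nnm_wrt (G n) (fn n).
Hypothesis fnP : forall n h, nnm_wrt (G n) h ->
  \int[mu]_x (h x * (f x * w x))%:E = \int[mu]_x (h x * (fn n x * w x))%:E.

Let p0 : (0 < p)%R. Proof. exact: lt_trans p1. Qed.
Let r1 : (1 < r)%R. Proof. exact: conjugate_gt1 p1 pr. Qed.
Let r0 : (0 < r)%R. Proof. exact: lt_trans r1. Qed.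

Let nfn_le k n : (k <= n)%N -> nnm_wrt (G n) (fn k).
Proof. by move=> kn; exact: nnm_wrt_mono (Gnd kn) (nfn k). Qed.

Let cut (L k : nat) (x : T) : R := Num.min (fn k x) L%:R.

Let ncut L k n : (k <= n)%N -> nnm_wrt (G n) (cut L k).
Proof.
by move=> kn; apply: nnm_min; [exact: nfn_le|apply: nnm_cst; rewrite ler0n].
Qed.

Let cut_ge0 L k x : (0 <= cut L k x)%R.
Proof. by rewrite le_min (nfn k).2 ler0n. Qed.

Let nMG L n m : (n <= m)%N -> nnm_wrt (G m) (fun x => run_max (cut L ^~ x) n).
Proof. by move=> nm; apply: nnm_run_max => k kn; apply: ncut; exact: leq_trans nm. Qed.

Let nM L n : nnm (fun x => run_max (cut L ^~ x) n).
Proof. exact: (nnm_sub (@Gm n) (nMG L (leqnn n))). Qed.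

Let nincr L n : nnm_wrt (G n) (fun x => run_max_incr p (cut L ^~ x) n).
Proof.
split=> [|x]; last by apply: run_max_incr_ge0.
case: n => [|n]; first by apply: (nnm_powR _ _).1; exact: ncut.
apply: measurable_funB.
- exact: (nnm_powR (p - 1) (nMG L (leqnn n.+1))).1.
- exact: (nnm_powR (p - 1) (nMG L (leqnSn n))).1.
Qed.

(** The increments of [doob_pathwise] are measurable at their own time, so in the
integral fn k may be replaced by f in each term; the sum then telescopes to
M^(p-1) f.  Truncation at level [L] makes the integral of M^p finite, which
permits its absorption on the left. *)
Lemma doob_truncated L N :
  \int[mu]_x (run_max (cut L ^~ x) N `^ p * w x)%:E <=
  (doob_constant p r)%:E * \int[mu]_x (f x `^ p * w x)%:E.
Proof.
pose M x := run_max (cut L ^~ x) N.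
have M0 x : (0 <= M x)%R by exact: (nM L N).2.
have nMp : nnm (fun x => M x `^ p * w x)%R := nnm_mul (nnm_powR p (nM L N)) nw.
have nfp : nnm (fun x => f x `^ p * w x)%R := nnm_mul (nnm_powR p nf) nw.
(* Chosen such that the power t^r is 1 / (2 r), half of the coefficient on the
   left of [step1]. *)
pose t : R := ((2 * r)^-1 `^ r^-1)%R.
have r20 : (0 < (2 * r)^-1 :> R)%R by rewrite invr_gt0 mulr_gt0.
have t0 : (0 < t)%R by exact: powR_gt0.
have tr : (t `^ r = (2 * r)^-1)%R.
  by rewrite /t -powRrM mulVf ?gt_eqF// powRr1// ltW.
have nD k : nnm (fun x => run_max_incr p (cut L ^~ x) k).
  exact: (nnm_sub (@Gm k) (nincr L k)).
have nfk k : nnm (fn k) by exact: (nnm_sub (@Gm k) (nfn k)).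
have nDg k (g : T -> R) : nnm g ->
    nnm (fun x => run_max_incr p (cut L ^~ x) k * (g x * w x))%R.
  by move=> ng; exact: nnm_mul (nD k) (nnm_mul ng nw).
have step1 : \int[mu]_x (r^-1 * (M x `^ p * w x))%:E <=
    \int[mu]_x (M x `^ (p - 1) * (f x * w x))%:E.
  apply: (@le_trans _ _ (\int[mu]_x (\sum_(k < N.+1)
      run_max_incr p (cut L ^~ x) k * (fn k x * w x))%:E)).
    apply: le_int.
    - by apply: nnm_mul => //; apply: nnm_cst; rewrite invr_ge0 ltW.
    - apply: (@nnm_sum _ T R _ (index_enum 'I_N.+1) xpredT (fun (k : 'I_N.+1) x =>
        run_max_incr p (cut L ^~ x) k * (fn k x * w x))%R) => k _; exact: nDg.
    - move=> x; under eq_bigr do rewrite mulrA.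
      rewrite -mulr_suml mulrA ler_wpM2r ?nw.2//.
      apply: (@doob_pathwise _ p r (cut L ^~ x) (fn ^~ x) N p1 pr) => k.
      by rewrite cut_ge0 ge_min lexx.
  rewrite int_sum; last by move=> k; exact: nDg.
  under eq_bigr do rewrite -(fnP (nincr L _)).
  rewrite -int_sum; last by move=> k; exact: nDg.
  under eq_integral do rewrite -mulr_suml sum_run_max_incr.
  by [].
have step2 : \int[mu]_x (M x `^ (p - 1) * (f x * w x))%:E <=
    \int[mu]_x ((2 * r)^-1 * (M x `^ p * w x) + (t^-1) `^ p * (f x `^ p * w x))%:E.
  apply: le_int.
  - exact: nnm_mul (nnm_powR _ (nM L N)) (nnm_mul nf nw).
  - apply: nnm_add; apply: nnm_mul => //; apply: nnm_cst; first exact: ltW.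
    exact: powR_ge0.
  - move=> x; rewrite !mulrA -mulrDl ler_wpM2r ?nw.2//.
    have rp : (r^-1 + p^-1 = 1)%R by rewrite addrC.
    apply: (le_trans (young_weighted r1 rp (powR_ge0 _ _) (nf.2 x) t0)).
    rewrite lerD//; last by rewrite mulrC powRM ?invr_ge0 ?(ltW t0) ?nf.2.
    rewrite powRM ?(ltW t0) ?powR_ge0// tr -powRrM.
    rewrite (_ : (p - 1) * r = p)%R//.
    have rE : (r^-1 = 1 - p^-1)%R by rewrite -pr addrAC subrr add0r.
    rewrite -[r]invrK rE.
    have pn1 : (p - 1 != 0)%R by rewrite subr_eq0 gt_eqF.
    by field; rewrite gt_eqF// pn1.
have Mfin : \int[mu]_x (M x `^ p * w x)%:E < +oo.
  apply: (@le_lt_trans _ _ (\int[mu]_x (L%:R `^ p * w x)%:E)).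
    apply: le_int => //.
      by apply: nnm_mul => //; apply: nnm_cst; exact: powR_ge0.
    move=> x; rewrite ler_wpM2r ?nw.2// le_powR// ?(ltW p0)//.
    by apply: run_max_le => k; rewrite ge_min lexx orbT.
  by rewrite intZ ?powR_ge0// lte_mul_pinfty// lee_fin powR_ge0.
have := le_trans step1 step2.
rewrite intZ//; last by rewrite invr_ge0 ltW.
rewrite intD; last 2 first.
- by apply: nnm_mul => //; apply: nnm_cst; exact: ltW.
- by apply: nnm_mul => //; apply: nnm_cst; exact: powR_ge0.
rewrite intZ ?(ltW r20)// intZ ?powR_ge0//.
have := int_ge0 mu nfp; have := int_ge0 mu nMp.
move: Mfin; rewrite /M.
move: (\int[mu]_x (run_max (cut L ^~ x) N `^ p * w x)%:E) => A.
move: (\int[mu]_x (f x `^ p * w x)%:E) => B.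
rewrite /doob_constant -/t.
case: A => [A| |]// _; case: B => [B| |]//; last first.
  move=> _ _ _; rewrite mulry gtr0_sg ?mul1e ?leey//.
  by rewrite mulr_gt0// ?powR_gt0 ?invr_gt0// mulr_gt0.
rewrite -!EFinM -EFinD !lee_fin => A0 B0.
set c := (t^-1 `^ p)%R => h.
have rE : (r^-1 = 2 * (2 * r)^-1)%R by rewrite invfM mulrA mulfV// mul1r.
have : ((2 * r)^-1 * A <= c * B)%R by move: h; rewrite rE; lra.
by rewrite mulrC ler_pdivrMr ?mulr_gt0// => /le_trans; apply; rewrite mulrC !mulrA.
Qed.

Lemma doob_maximal N :
  \int[mu]_x (run_max (fn ^~ x) N `^ p * w x)%:E <=
  (doob_constant p r)%:E * \int[mu]_x (f x `^ p * w x)%:E.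
Proof.
apply: (@le_int_lim _ _ _ mu (fun L x => run_max (cut L ^~ x) N `^ p * w x)%R).
- by move=> L; exact: nnm_mul (nnm_powR p (nM L N)) nw.
- move=> x L L' LL'; rewrite ler_wpM2r ?nw.2// le_powR ?(ltW p0)//.
    exact: (nM L N).2.
  apply: le_run_max => k; rewrite le_min !ge_min lexx/=.
  by rewrite ler_nat LL' orbT.
- move=> x; apply: cvg_near_cst.
  exists (Num.truncn (run_max (fn ^~ x) N)).+1 => // L /= NL.
  congr (_ `^ _ * _)%R; apply: eq_run_max => k kN.
  rewrite /cut min_l//; apply: (le_trans (run_max_ge (fn ^~ x) kN)).
  apply: ltW; apply: (lt_le_trans (truncnS_gt _)).
  by rewrite ler_nat.
- by move=> L; exact: doob_truncated.
Qed.

End doob.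

(** * The times at which the stage of the second factor started last *)
Section measurable_stage.
Context {d : measure_display} {T : measurableType d} {R : realType}.

(** Both statements are needed in the induction: whether a new stage starts
depends on the value at the start of the current one. *)
Lemma measurable_stage (u : nat -> T -> R) n : (forall k, (k <= n)%N -> nnm (u k)) ->
  measurable_fun [set: T] (fun x => stage (u ^~ x) n) /\
  measurable_fun [set: T] (fun x => u (stage (u ^~ x) n) x).
Proof.
elim: n => [|n ih] nu; first by split; [exact: measurable_cst|exact: (nu 0%N _).1].
have [ms mA] := ih (fun k kn => nu k (leqW kn)).
have mnew : measurable_fun [set: T]
    (fun x => 2 * u (stage (u ^~ x) n) x < u n.+1 x)%R.
  apply: measurable_fun_ltr; last exact: (nu n.+1 _).1.
  by apply: measurable_funM => //; exact: measurable_cst.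
split; first by apply: measurable_fun_ifT => //; exact: measurable_cst.
rewrite (_ : (fun x => _) = (fun x => if (2 * u (stage (u ^~ x) n) x < u n.+1 x)%R
    then u n.+1 x else u (stage (u ^~ x) n) x)).
  by apply: measurable_fun_ifT => //; exact: (nu n.+1 _).1.
by apply/funext => x /=; case: ifP.
Qed.

End measurable_stage.

Definition half_constant {R : realType} (p q p' q' : R) : R :=
  (2 * (4 * ((2 * doob_constant p p') `^ (q / p) + 2 * doob_constant q' q)))%R.

Lemma half_constant_ge0 {R : realType} (p q p' q' : R) :
  (1 < p)%R -> (1 < q)%R -> (p^-1 + p'^-1 = 1)%R -> (q^-1 + q'^-1 = 1)%R ->
  (0 <= half_constant p q p' q')%R.
Proof.
move=> p1 q1 pp' qq'; have q'1 := conjugate_gt1 q1 qq'.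
rewrite !mulr_ge0// addr_ge0 ?powR_ge0// mulr_ge0// doob_constant_ge0//.
by rewrite addrC.
Qed.

Lemma poweR_homogeneous {R : realType} (p q C D a : R) :
  (0 < p)%R -> (0 <= C)%R -> (0 <= D)%R -> (0 <= a)%R ->
  (C `^ q)%:E * (D * a `^ p)%:E `^ (q / p) = (D `^ (q / p) * (C * a) `^ q)%:E.
Proof.
move=> p0 C0 D0 a0; rewrite poweR_EFin -EFinM; congr EFin.
rewrite powRM ?powR_ge0// -powRrM [(p * _)%R]mulrC divfK ?gt_eqF//.
by rewrite (powRM q C0 a0) mulrCA.
Qed.

Lemma ler_sum_mul {R : realType} (x y z w : R) : (0 <= x)%R -> (0 <= y)%R ->
  (0 <= z)%R -> (0 <= w)%R -> (x * z + y * w <= (x + y) * (z + w))%R.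
Proof.
move=> x0 y0 z0 w0; rewrite mulrDl !mulrDr lerD// ?lerDl ?lerDr mulr_ge0//.
Qed.

Section half_of_the_sum.
Context {d : measure_display} {T : measurableType d} {R : realType}.
Variable mu : {measure set T -> \bar R}.
Variable G : nat -> set (set T).
Hypothesis Gm : forall n, G n `<=` measurable.
Hypothesis Gnd : forall n m, (n <= m)%N -> G n `<=` G m.
Variables (p q p' q' : R).
Hypothesis p1 : (1 < p)%R.
Hypothesis pq : (p <= q)%R.
Hypothesis pp' : (p^-1 + p'^-1 = 1)%R.
Hypothesis qq' : (q^-1 + q'^-1 = 1)%R.
Variables (sg om f g : T -> R) (fn gn c : nat -> T -> R).
Hypothesis nsg : nnm sg.
Hypothesis sgfin : \int[mu]_x (sg x)%:E < +oo.
Hypothesis nom : nnm om.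
Hypothesis omfin : \int[mu]_x (om x)%:E < +oo.
Hypothesis nf : nnm f.
Hypothesis ng : nnm g.
Hypothesis nfn : forall n, nnm_wrt (G n) (fn n).
Hypothesis ngn : forall n, nnm_wrt (G n) (gn n).
Hypothesis fnP : forall n h, nnm_wrt (G n) h ->
  \int[mu]_x (h x * (f x * sg x))%:E = \int[mu]_x (h x * (fn n x * sg x))%:E.
Hypothesis gnP : forall n h, nnm_wrt (G n) h ->
  \int[mu]_x (h x * (g x * om x))%:E = \int[mu]_x (h x * (gn n x * om x))%:E.
Hypothesis nc : forall n, nnm_wrt (G n) (c n).
Variables (N : nat) (C : R).
Hypothesis C0 : (0 <= C)%R.
Hypothesis test : forall (m : nat) (E : set T), (G m).-sigma.-measurable E ->
  \int[mu]_(x in E) ((\sum_(j < N.+1 | (m <= j)%N) c j x) `^ q * om x)%:E <=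
  (C `^ q)%:E * (\int[mu]_(x in E) (sg x)%:E) `^ (q / p).

Let p0 : (0 < p)%R. Proof. exact: lt_trans p1. Qed.
Let q1 : (1 < q)%R. Proof. exact: lt_le_trans pq. Qed.
Let q0 : (0 < q)%R. Proof. exact: lt_trans q1. Qed.
Let q'1 : (1 < q')%R. Proof. exact: conjugate_gt1 q1 qq'. Qed.
Let q'0 : (0 < q')%R. Proof. exact: lt_trans q'1. Qed.
Let q'q : (q'^-1 + q^-1 = 1)%R. Proof. by rewrite addrC. Qed.
Let qp1 : (1 <= q / p)%R. Proof. by rewrite ler_pdivlMr// mul1r. Qed.

Let fn0 x k : (0 <= fn k x)%R. Proof. exact: (nfn k).2. Qed.
Let gn0 x k : (0 <= gn k x)%R. Proof. exact: (ngn k).2. Qed.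
Let cn0 x k : (0 <= c k x)%R. Proof. exact: (nc k).2. Qed.

Let sub n (h : T -> R) : nnm_wrt (G n) h -> nnm h.
Proof. exact: nnm_sub. Qed.

Let nfn_le k n : (k <= n)%N -> nnm_wrt (G n) (fn k).
Proof. by move=> kn; exact: nnm_wrt_mono (Gnd kn) (nfn k). Qed.

Let ngn_le k n : (k <= n)%N -> nnm_wrt (G n) (gn k).
Proof. by move=> kn; exact: nnm_wrt_mono (Gnd kn) (ngn k). Qed.

Let start (u : nat -> T -> R) (m : nat) (x : T) : R := (stage (u ^~ x) m == m)%:R.

Let nstart (u : nat -> T -> R) m : (forall k, (k <= m)%N -> nnm_wrt (G m) (u k)) ->
  nnm_wrt (G m) (start u m).
Proof.
move=> nu; apply: nnm_bool; apply: measurable_fun_eqn; last exact: measurable_cst.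
by have [] := measurable_stage nu.
Qed.

Let nstartf m : nnm_wrt (G m) (start fn m).
Proof. by apply: nstart => k; exact: nfn_le. Qed.

Let nstartg m : nnm_wrt (G m) (start gn m).
Proof. by apply: nstart => k; exact: ngn_le. Qed.

Let sum_start (u : nat -> T -> R) (e : R) x : (1 < e)%R -> (forall k, (0 <= u k x)%R) ->
  (\sum_(m < N.+1) (start u m x * u m x) `^ e <= 2 * run_max (u ^~ x) N `^ e)%R.
Proof.
move=> e1 u0; have e0 : (0 < e)%R by exact: lt_trans e1.
apply: (@le_trans _ _ (2 * u (stage (u ^~ x) N) x `^ e)%R).
  apply: le_trans (sum_stage N (ltW e1) u0).
  rewrite [leRHS]big_mkcond; apply: ler_sum => m _; rewrite /start.
  by case: ifP => _; rewrite ?mul1r// mul0r powR0// gt_eqF.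
rewrite ler_pM2l//; apply: le_powR => //; first exact: ltW.
by apply: (run_max_ge (u ^~ x)); exact: stage_le.
Qed.

Let int_starts (u : nat -> T -> R) (v w : T -> R) (e e' : R) (B : R) :
  (1 < e)%R -> (e^-1 + e'^-1 = 1)%R -> nnm v -> nnm w -> \int[mu]_x (w x)%:E < +oo ->
  (forall n, nnm_wrt (G n) (u n)) ->
  (forall n h, nnm_wrt (G n) h ->
    \int[mu]_x (h x * (v x * w x))%:E = \int[mu]_x (h x * (u n x * w x))%:E) ->
  \int[mu]_x (v x `^ e * w x)%:E <= B%:E ->
  \int[mu]_x (\sum_(m < N.+1) ((start u m x * u m x) `^ e * w x))%:E <=
  (2 * doob_constant e e' * B)%:E.
Proof.
move=> e1 ee' nv nw wfin nu uP vB.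
have nu_le k n : (k <= n)%N -> nnm_wrt (G n) (u k).
  by move=> kn; exact: nnm_wrt_mono (Gnd kn) (nu k).
have nrun : nnm (fun x => run_max (u ^~ x) N `^ e * w x)%R.
  apply: nnm_mul => //; apply: nnm_powR; apply: (sub (n := N)).
  by apply: nnm_run_max => k; exact: nu_le.
apply: (@le_trans _ _ (\int[mu]_x (2 * (run_max (u ^~ x) N `^ e * w x))%:E)).
  apply: le_int.
  - apply: (@nnm_sum _ T R _ (index_enum 'I_N.+1) xpredT
      (fun (m : 'I_N.+1) x => (start u m x * u m x) `^ e * w x)%R) => m _.
    have ns : nnm_wrt (G m) (start u m) by apply: nstart => k; exact: nu_le.
    exact: nnm_mul (nnm_powR e (sub (nnm_mul ns (nu m)))) nw.
  - by apply: nnm_mul => //; exact: nnm_cst.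
  - move=> x; rewrite -mulr_suml mulrA ler_wpM2r ?nw.2//.
    by apply: sum_start => // k; exact: (nu k).2.
rewrite intZ// -mulrA EFinM lee_pmul2l//.
apply: (le_trans (doob_maximal Gm Gnd e1 ee' nw wfin nv nu uP N)).
by rewrite [leRHS]EFinM; apply: lee_wpmul2l => //; rewrite lee_fin doob_constant_ge0.
Qed.

Let Th (m : nat) (x : T) : R := (\sum_(j < N.+1 | (m <= j)%N) c j x)%R.

Let nTh m : nnm (Th m).
Proof.
apply: (@nnm_sum _ T R _ (index_enum 'I_N.+1) (fun j => (m <= j)%N)
  (fun (j : 'I_N.+1) x => c j x)) => j _; exact: sub (nc j).
Qed.

Let h (m : nat) (x : T) : R := (start fn m x * fn m x)%R.

Let nh m : nnm_wrt (G m) (h m). Proof. exact: nnm_mul (nstartf m) (nfn m). Qed.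

(** The test, stated for sets, is applied to the function (h m)^p, whose power
q / p is (h m)^q. *)
Let int_stage_tested m :
  \int[mu]_x (h m x `^ q * (Th m x `^ q * om x))%:E <=
  (C `^ q)%:E * (\int[mu]_x (h m x `^ p * sg x)%:E) `^ (q / p).
Proof.
have hq x : (h m x `^ q = (h m x `^ p) `^ (q / p))%R.
  by rewrite -powRrM mulrC divfK// gt_eqF.
under eq_integral do rewrite hq.
apply: (le_int_gauge (@Gm m)) => //.
- by apply: nnm_mul => //; exact: nnm_powR.
- exact: powR_ge0.
- by move=> E mE; exact: test.
- exact: nnm_powR (nh m).
Qed.

(** [stage_pairing] is integrated against om.  The first sum is estimated by the
test and Doob's inequality for [f], the second by Doob's inequality for [g]
alone. *)
Lemma half_of_the_sum (a b : R) : (0 <= a)%R -> (0 <= b)%R ->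
  \int[mu]_x (f x `^ p * sg x)%:E <= (a `^ p)%:E ->
  \int[mu]_x (g x `^ q' * om x)%:E <= (b `^ q')%:E ->
  \int[mu]_x ((\sum_(n < N.+1 | (stage (fn ^~ x) n <= stage (gn ^~ x) n)%N)
     c n x * fn n x * gn n x) * om x)%:E <=
  (half_constant p q p' q' * (C * a) * b)%:E.
Proof.
move=> a0 b0 fa gb.
pose D1 : R := ((2 * doob_constant p p') `^ (q / p))%R.
pose D2 : R := (2 * doob_constant q' q)%R.
have D10 : (0 <= D1)%R by exact: powR_ge0.
have D20 : (0 <= D2)%R by rewrite mulr_ge0// doob_constant_ge0.
apply: (young_optimize q1 qq') => //.
- by rewrite mulr_ge0// addr_ge0.
- exact: mulr_ge0.
move=> t t0.
pose U x : R := (\sum_(m < N.+1) h m x `^ q * (Th m x `^ q * om x))%R.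
pose V x : R := (\sum_(m < N.+1) (start gn m x * gn m x) `^ q' * om x)%R.
have nU1 m : nnm (fun x => h m x `^ q * (Th m x `^ q * om x))%R.
  exact: nnm_mul (nnm_powR q (sub (nh m))) (nnm_mul (nnm_powR q (nTh m)) nom).
have nU : nnm U.
  exact: (@nnm_sum _ T R _ (index_enum 'I_N.+1) xpredT
    (fun (m : 'I_N.+1) x => h m x `^ q * (Th m x `^ q * om x))%R) (fun m _ => nU1 m).
have nV : nnm V.
  apply: (@nnm_sum _ T R _ (index_enum 'I_N.+1) xpredT
    (fun (m : 'I_N.+1) x => (start gn m x * gn m x) `^ q' * om x)%R) => m _.
  exact: nnm_mul (nnm_powR q' (sub (nnm_mul (nstartg m) (ngn m)))) nom.
have UB : \int[mu]_x (U x)%:E <= (D1 * (C * a) `^ q)%:E.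
  rewrite int_sum//.
  apply: (@le_trans _ _ (\sum_(m < N.+1)
      (C `^ q)%:E * (\int[mu]_x (h m x `^ p * sg x)%:E) `^ (q / p))).
    by apply: lee_sum => m _; exact: int_stage_tested.
  rewrite -ge0_sume_distrr; last by move=> m _; rewrite poweR_ge0.
  have nhp m : nnm (fun x => h m x `^ p * sg x)%R.
    exact: nnm_mul (nnm_powR p (sub (nh m))) nsg.
  apply: (@le_trans _ _ ((C `^ q)%:E *
      (\sum_(m < N.+1) \int[mu]_x (h m x `^ p * sg x)%:E) `^ (q / p))).
    apply: lee_wpmul2l; first by rewrite lee_fin powR_ge0.
    by apply: poweR_superadd_sum => // m; exact: int_ge0.
  rewrite -int_sum//.
  have hB := int_starts p1 pp' nf nsg sgfin nfn fnP fa.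
  apply: (@le_trans _ _ ((C `^ q)%:E * ((2 * doob_constant p p' * a `^ p)%:E) `^ (q / p))).
    apply: lee_wpmul2l; first by rewrite lee_fin powR_ge0.
    apply: le_poweR => //; first by rewrite divr_ge0 ?ltW.
    apply: int_ge0; exact: (@nnm_sum _ T R _ (index_enum 'I_N.+1) xpredT
      (fun (m : 'I_N.+1) x => h m x `^ p * sg x)%R) (fun m _ => nhp m).
  have DD0 : (0 <= 2 * doob_constant p p')%R by rewrite mulr_ge0// doob_constant_ge0.
  rewrite (poweR_homogeneous q p0 C0 DD0 a0).
  exact: lexx.
have VB : \int[mu]_x (V x)%:E <= (D2 * b `^ q')%:E.
  exact: int_starts gb.
have ti0 : (0 <= t^-1)%R by rewrite invr_ge0 ltW.
apply: (@le_trans _ _ (\int[mu]_x (4 * (t `^ q * U x + t^-1 `^ q' * V x))%:E)).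
  have nX : nnm (fun x => (\sum_(n < N.+1 | (stage (fn ^~ x) n <= stage (gn ^~ x) n)%N)
     c n x * fn n x * gn n x) * om x)%R.
    apply: nnm_mul => //.
    apply: (nnm_ext (u := fun x => (\sum_(n < N.+1)
       (stage (fn ^~ x) n <= stage (gn ^~ x) n)%N%:R * (c n x * fn n x * gn n x))%R)).
      move=> x; rewrite [RHS]big_mkcond; apply: eq_bigr => n _.
      by case: ifP => _; rewrite ?mul1r ?mul0r.
    apply: (@nnm_sum _ T R _ (index_enum 'I_N.+1) xpredT (fun (n : 'I_N.+1) x =>
       (stage (fn ^~ x) n <= stage (gn ^~ x) n)%N%:R * (c n x * fn n x * gn n x))%R) => n _.
    apply: (sub (n := n)); apply: (nnm_mul _ (nnm_mul (nnm_mul (nc n) (nfn n)) (ngn n))).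
    apply: nnm_bool; apply: measurable_fun_leq.
      exact: (@measurable_stage _ (g_sigma_algebraType (G n)) R fn n
        (fun k kn => nfn_le kn)).1.
    exact: (@measurable_stage _ (g_sigma_algebraType (G n)) R gn n
      (fun k kn => ngn_le kn)).1.
  apply: le_int => //.
    apply: nnm_mul; first exact: nnm_cst.
    by apply: nnm_add; apply: nnm_mul => //; apply: nnm_cst; exact: powR_ge0.
  move=> x; have := @stage_pairing _ (fn ^~ x) (gn ^~ x) (c ^~ x) N.+1 q q' t q1 qq' t0
    (fn0 x) (gn0 x) (cn0 x).
  move=> /(ler_wpM2r (nom.2 x)) /le_trans; apply.
  rewrite -mulrA ler_pM2l// mulrDl; apply: lerD.
    rewrite mulr_suml /U mulr_sumr; apply: ler_sum => m _.
    rewrite powRM ?(ltW t0)//; last first.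
      rewrite mulr_ge0//; first exact: (sub (nh m)).2.
      exact: (nTh m).2.
    by rewrite powRM ?(sub (nh m)).2 ?(nTh m).2// !mulrA.
  rewrite big_mkcond mulr_suml /V mulr_sumr; apply: ler_sum => m _ /=.
  rewrite /start; case: ifP => _; last first.
    by rewrite !mul0r powR0 ?gt_eqF// mul0r mulr0.
  by rewrite mul1r powRM// [(_ `^ _ * (t^-1) `^ _)%R]mulrC mulrA.
have ntU : nnm (fun x => t `^ q * U x)%R by apply: nnm_mul => //; exact/nnm_cst/powR_ge0.
have ntV : nnm (fun x => t^-1 `^ q' * V x)%R by apply: nnm_mul => //; exact/nnm_cst/powR_ge0.
rewrite intZ//; last exact: nnm_add.
rewrite -mulrA EFinM; apply: lee_wpmul2l => //.
rewrite intD// intZ ?powR_ge0// intZ ?powR_ge0//.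
apply: (@le_trans _ _ ((t `^ q)%:E * (D1 * (C * a) `^ q)%:E +
    (t^-1 `^ q')%:E * (D2 * b `^ q')%:E)).
  by apply: leeD; apply: lee_wpmul2l => //; rewrite lee_fin powR_ge0.
rewrite -!EFinM -EFinD lee_fin.
rewrite (powRM q (ltW t0) (mulr_ge0 C0 a0)) (powRM q' b0 ti0).
have tCa : (0 <= t `^ q * (C * a) `^ q)%R by rewrite mulr_ge0 ?powR_ge0.
have bt : (0 <= b `^ q' * t^-1 `^ q')%R by rewrite mulr_ge0 ?powR_ge0.
apply: le_trans (ler_sum_mul D10 D20 tCa bt); rewrite le_eqVlt; apply/orP; left.
by apply/eqP; congr (_ + _)%R; rewrite mulrCA// [(b `^ q' * _)%R]mulrC.
Qed.

End half_of_the_sum.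

(** * A finite window of the form *)
Section quotient.
Context {d : measure_display} {T : measurableType d} {R : realType}.
Variable mu : {measure set T -> \bar R}.
Variable G : set (set T).
Hypothesis Gm : G `<=` measurable.

(** The quotient is the conditional expectation of [f] for the measure with
density [w].  Where S = 0, [w] vanishes almost everywhere, hence so does phi,
and the value given to phi / 0 does not matter. *)
Lemma cond_version_quotient (w S f phi : T -> R) : nnm w -> nnm f ->
  cond_version mu G w S -> cond_version mu G (fun x => f x * w x)%R phi ->
  nnm_wrt G (fun x => phi x / S x)%R /\ forall h, nnm_wrt G h ->
    \int[mu]_x (h x * (f x * w x))%:E = \int[mu]_x (h x * (phi x / S x * w x))%:E.
Proof.
move=> nw nf [nS wS] [np fwp].
have nq : nnm_wrt G (fun x => phi x / S x)%R by apply: nnm_mul => //; exact: nnm_inv.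
split=> // h nh.
(* The indicator of the set where the quotient is degenerate. *)
pose z x : R := ((S x == 0)%:R)%R.
have nz : nnm_wrt G z.
  apply: nnm_bool; apply: measurable_fun_eqr; first exact: nS.1.
  exact: measurable_cst.
have zw : {ae mu, forall x, (z x * w x = 0)%R}.
  apply: int0_ae; first exact: nnm_mul (nnm_sub Gm nz) nw.
  rewrite wS// (eq_integral (fun=> 0)) ?integral0// => x _; congr EFin.
  by rewrite /z; have [->|_] := eqVneq (S x) 0%R; rewrite ?mulr0 ?mul0r.
have sub (h' : T -> R) : nnm_wrt G h' -> nnm h' by exact: nnm_sub.
rewrite fwp//.
have -> : \int[mu]_x (h x * (phi x / S x * w x))%:E =
    \int[mu]_x ((h x * (phi x / S x)) * w x)%:E.
  by apply: eq_integral => x _; rewrite mulrA.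
rewrite wS; last exact: nnm_mul.
transitivity (\int[mu]_x (h x * (phi x / S x) * S x + h x * z x * phi x)%:E).
  apply: eq_integral => x _; congr EFin.
  rewrite /z; have [->|S0] := eqVneq (S x) 0%R.
    by rewrite mulr0 add0r mulr1.
  by rewrite mulr0 mul0r addr0 -mulrA divfK.
rewrite intD; last 2 first.
- exact: nnm_mul (nnm_mul (sub _ nh) (sub _ nq)) (sub _ nS).
- exact: nnm_mul (nnm_mul (sub _ nh) (sub _ nz)) (sub _ np).
rewrite -[X in _ + X]fwp; last exact: nnm_mul.
rewrite [X in _ + X](_ : _ = 0) ?adde0//.
rewrite (@eq_int_ae _ _ _ mu _ (fun=> 0%R)); first exact: integral0.
- exact: nnm_mul (nnm_mul (sub _ nh) (sub _ nz)) (nnm_mul nf nw).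
- exact: nnm_cst.
- move: zw; apply: filterS => x zw0.
  by rewrite -mulrA [(f x * _)%R]mulrC [(z x * _)%R]mulrA zw0 mul0r mulr0.
Qed.

Lemma cond_version_indic (E : set T) (k s : T -> R) :
  G.-sigma.-measurable E -> cond_version mu G k s ->
  cond_version mu G (fun x => \1_E x * k x)%R (fun x => \1_E x * s x)%R.
Proof.
move=> mE [ns ks]; have nE : nnm_wrt G (\1_E : T -> R) by exact: nnm_indic.
split=> [|h nh]; first exact: nnm_mul.
under eq_integral do rewrite mulrA.
under [RHS]eq_integral do rewrite mulrA.
by apply: ks; exact: nnm_mul.
Qed.

(** A conditional expectation may be removed from one factor of a product as soon
as all the other factors are measurable; this is done here first for phi, then
for gam, exchanging each time the function for the measure. *)
Lemma int_mul_cond (sg om f g S phi gam gq h : T -> R) :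
  nnm sg -> nnm om -> nnm f -> nnm g ->
  cond_version mu G sg S ->
  cond_version mu G (fun x => f x * sg x)%R phi ->
  cond_version mu G (fun x => g x * om x)%R gam ->
  nnm_wrt G gq ->
  (forall k, nnm_wrt G k ->
    \int[mu]_x (k x * (g x * om x))%:E = \int[mu]_x (k x * (gq x * om x))%:E) ->
  nnm_wrt G h ->
  \int[mu]_x (h x * phi x * gam x)%:E =
  \int[mu]_x (h x * (S x * (phi x / S x)) * gq x * om x)%:E.
Proof.
move=> nsg nom nf ng SP phiP gamP ngq gqP nh.
have [nfq fqP] := cond_version_quotient nsg nf SP phiP.
have nS := SP.1; have nphi := phiP.1; have ngam := gamP.1.
transitivity (\int[mu]_x ((h x * gam x) * phi x)%:E).
  by apply: eq_integral => x _; rewrite mulrAC.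
rewrite -phiP.2; last exact: nnm_mul.
rewrite fqP; last exact: nnm_mul.
transitivity (\int[mu]_x ((h x * gam x * (phi x / S x)) * sg x)%:E).
  by apply: eq_integral => x _; rewrite !mulrA.
rewrite SP.2; last by apply: nnm_mul => //; exact: nnm_mul.
transitivity (\int[mu]_x ((h x * (S x * (phi x / S x))) * gam x)%:E).
  by apply: eq_integral => x _; congr EFin; ring.
have nhS : nnm_wrt G (fun x => h x * (S x * (phi x / S x)))%R.
  exact: nnm_mul nh (nnm_mul nS nfq).
rewrite -gamP.2// gqP//.
by apply: eq_integral => x _; rewrite !mulrA.
Qed.

End quotient.

Section both_halves.
Context {d : measure_display} {T : measurableType d} {R : realType}.
Variable mu : {measure set T -> \bar R}.
Variable G : nat -> set (set T).
Hypothesis Gm : forall n, G n `<=` measurable.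
Hypothesis Gnd : forall n m, (n <= m)%N -> G n `<=` G m.
Variables (p q p' q' : R).
Hypothesis p1 : (1 < p)%R.
Hypothesis pq : (p <= q)%R.
Hypothesis pp' : (p^-1 + p'^-1 = 1)%R.
Hypothesis qq' : (q^-1 + q'^-1 = 1)%R.
Variables (sg om f g : T -> R) (S W phi gam al : nat -> T -> R).
Hypothesis nsg : nnm sg.
Hypothesis sgfin : \int[mu]_x (sg x)%:E < +oo.
Hypothesis nom : nnm om.
Hypothesis omfin : \int[mu]_x (om x)%:E < +oo.
Hypothesis nf : nnm f.
Hypothesis ng : nnm g.
Hypothesis nal : forall n, nnm_wrt (G n) (al n).
Hypothesis SP : forall n, cond_version mu (G n) sg (S n).
Hypothesis WP : forall n, cond_version mu (G n) om (W n).
Hypothesis phiP : forall n, cond_version mu (G n) (fun x => f x * sg x)%R (phi n).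
Hypothesis gamP : forall n, cond_version mu (G n) (fun x => g x * om x)%R (gam n).
Variables (N : nat) (C1 C2 : R).
Hypothesis C10 : (0 <= C1)%R.
Hypothesis C20 : (0 <= C2)%R.
Hypothesis test1 : forall (m : nat) (E : set T), (G m).-sigma.-measurable E ->
  \int[mu]_(x in E) ((\sum_(j < N.+1 | (m <= j)%N) S j x * al j x) `^ q * om x)%:E <=
  (C1 `^ q)%:E * (\int[mu]_(x in E) (sg x)%:E) `^ (q / p).
Hypothesis test2 : forall (m : nat) (E : set T), (G m).-sigma.-measurable E ->
  \int[mu]_(x in E) ((\sum_(j < N.+1 | (m <= j)%N) W j x * al j x) `^ p' * sg x)%:E <=
  (C2 `^ p')%:E * (\int[mu]_(x in E) (om x)%:E) `^ (p' / q').

Let sub n (h : T -> R) : nnm_wrt (G n) h -> nnm h.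
Proof. exact: nnm_sub. Qed.

Lemma both_halves (a b : R) : (0 <= a)%R -> (0 <= b)%R ->
  \int[mu]_x (f x `^ p * sg x)%:E <= (a `^ p)%:E ->
  \int[mu]_x (g x `^ q' * om x)%:E <= (b `^ q')%:E ->
  \sum_(n < N.+1) \int[mu]_x (al n x * phi n x * gam n x)%:E <=
  (half_constant p q p' q' * (C1 * a) * b +
   half_constant q' p' q p * (C2 * b) * a)%:E.
Proof.
move=> a0 b0 fa gb.
have q1 : (1 < q)%R by exact: lt_le_trans pq.
have q'1 := conjugate_gt1 q1 qq'.
have q'q : (q'^-1 + q^-1 = 1)%R by rewrite addrC.
have p'p : (p'^-1 + p^-1 = 1)%R by rewrite addrC.
have q'p' : (q' <= p')%R.
  have p'1 := conjugate_gt1 p1 pp'.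
  have gt1_pos (e : R) : (1 < e)%R -> (e \is Num.pos).
    by move=> e1; rewrite posrE (lt_trans _ e1).
  have : (q^-1 <= p^-1)%R by rewrite lef_pV2 ?gt1_pos//.
  by rewrite -[(q' <= _)%R]lef_pV2 ?gt1_pos//; move: pp' qq'; lra.
pose fn n x : R := (phi n x / S n x)%R.
pose gn n x : R := (gam n x / W n x)%R.
have fnP n := cond_version_quotient (@Gm n) nsg nf (SP n) (phiP n).
have gnP n := cond_version_quotient (@Gm n) nom ng (WP n) (gamP n).
have nfn n : nnm_wrt (G n) (fn n) by exact: (fnP n).1.
have ngn n : nnm_wrt (G n) (gn n) by exact: (gnP n).1.
have ncS n : nnm_wrt (G n) (fun x => S n x * al n x)%R by exact: nnm_mul (SP n).1 (nal n).
have ncW n : nnm_wrt (G n) (fun x => W n x * al n x)%R by exact: nnm_mul (WP n).1 (nal n).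
have H1 := half_of_the_sum Gm Gnd p1 pq pp' qq' nsg sgfin nom omfin nf ng nfn ngn
  (fun n => (fnP n).2) (fun n => (gnP n).2) ncS C10 test1 a0 b0 fa gb.
have H2 := half_of_the_sum Gm Gnd q'1 q'p' q'q p'p nom omfin nsg sgfin ng nf ngn nfn
  (fun n => (gnP n).2) (fun n => (fnP n).2) ncW C20 test2 b0 a0 gb fa.
rewrite EFinD; apply: le_trans (leeD H1 H2).
pose I1 n x : R := (stage (fn ^~ x) n <= stage (gn ^~ x) n)%N%:R.
pose I2 n x : R := (stage (gn ^~ x) n <= stage (fn ^~ x) n)%N%:R.
have nfn_le k n : (k <= n)%N -> nnm_wrt (G n) (fn k).
  by move=> kn; exact: nnm_wrt_mono (Gnd kn) (nfn k).
have ngn_le k n : (k <= n)%N -> nnm_wrt (G n) (gn k).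
  by move=> kn; exact: nnm_wrt_mono (Gnd kn) (ngn k).
have msf n := (@measurable_stage _ (g_sigma_algebraType (G n)) R fn n (fun k kn => nfn_le k n kn)).1.
have msg n := (@measurable_stage _ (g_sigma_algebraType (G n)) R gn n (fun k kn => ngn_le k n kn)).1.
have nI1 n : nnm_wrt (G n) (I1 n) by apply: nnm_bool; exact: measurable_fun_leq.
have nI2 n : nnm_wrt (G n) (I2 n) by apply: nnm_bool; exact: measurable_fun_leq.
have nIa (I : nat -> T -> R) n : nnm_wrt (G n) (I n) ->
  nnm_wrt (G n) (fun x => I n x * al n x)%R by move=> nI; exact: nnm_mul nI (nal n).
have nphi n := sub (phiP n).1; have ngam n := sub (gamP n).1.
(* Where the two stages start together, the term is counted twice. *)
have split_n n : \int[mu]_x (al n x * phi n x * gam n x)%:E <=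
    \int[mu]_x ((I1 n x * al n x) * phi n x * gam n x)%:E +
    \int[mu]_x ((I2 n x * al n x) * gam n x * phi n x)%:E.
  have n1 := nnm_mul (nnm_mul (sub (nIa _ _ (nI1 n))) (nphi n)) (ngam n).
  have n2 := nnm_mul (nnm_mul (sub (nIa _ _ (nI2 n))) (ngam n)) (nphi n).
  have n0 := nnm_mul (nnm_mul (sub (nal n)) (nphi n)) (ngam n).
  rewrite -intD//; apply: le_int => //; first exact: nnm_add.
  move=> x; rewrite (_ : I1 n x * al n x * phi n x * gam n x +
      I2 n x * al n x * gam n x * phi n x =
      (I1 n x + I2 n x) * (al n x * phi n x * gam n x))%R; last by ring.
  rewrite ler_peMl//; first exact: n0.2.
  rewrite /I1 /I2; case: leqP => [_|/ltnW ->]; last by rewrite add0r.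
  by rewrite lerDl.
apply: (@le_trans _ _ (\sum_(n < N.+1)
    (\int[mu]_x ((I1 n x * al n x) * phi n x * gam n x)%:E +
     \int[mu]_x ((I2 n x * al n x) * gam n x * phi n x)%:E))).
  by apply: lee_sum => n _; exact: split_n.
rewrite big_split/=; apply: leeD.
- pose Z (n : 'I_N.+1) x : R :=
    (I1 n x * al n x * (S n x * (phi n x / S n x)) * gn n x * om x)%R.
  have nZ n : nnm (Z n).
    apply: nnm_mul nom; apply: nnm_mul (sub (ngn n)).
    exact: nnm_mul (sub (nIa _ _ (nI1 n)))
      (nnm_mul (sub (SP n).1) (sub (nfn n))).
  apply: (@le_trans _ _ (\sum_(n < N.+1) \int[mu]_x (Z n x)%:E)).
    apply: lee_sum => n _.
    by rewrite (int_mul_cond (@Gm n) nsg nom nf ng (SP n) (phiP n) (gamP n)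
      (ngn n) (gnP n).2 (nIa _ _ (nI1 n))).
  rewrite -int_sum// le_eqVlt; apply/orP; left; apply/eqP.
  apply: eq_integral => x _; congr EFin.
  rewrite mulr_suml [RHS]big_mkcond; apply: eq_bigr => n _; rewrite /Z /I1 /fn /gn.
  by case: ifP => _; [rewrite mul1r; ring|rewrite !mul0r].
- pose Z (n : 'I_N.+1) x : R :=
    (I2 n x * al n x * (W n x * (gam n x / W n x)) * fn n x * sg x)%R.
  have nZ n : nnm (Z n).
    apply: nnm_mul nsg; apply: nnm_mul (sub (nfn n)).
    exact: nnm_mul (sub (nIa _ _ (nI2 n)))
      (nnm_mul (sub (WP n).1) (sub (ngn n))).
  apply: (@le_trans _ _ (\sum_(n < N.+1) \int[mu]_x (Z n x)%:E)).
    apply: lee_sum => n _.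
    by rewrite (int_mul_cond (@Gm n) nom nsg ng nf (WP n) (gamP n) (phiP n)
      (nfn n) (fnP n).2 (nIa _ _ (nI2 n))).
  rewrite -int_sum// le_eqVlt; apply/orP; left; apply/eqP.
  apply: eq_integral => x _; congr EFin.
  rewrite mulr_suml [RHS]big_mkcond; apply: eq_bigr => n _; rewrite /Z /I2 /fn /gn.
  by case: ifP => _; [rewrite mul1r; ring|rewrite !mul0r].
Qed.

End both_halves.

(** * The norm of the form as a sum of integrals *)
Section esum_of_integers.
Context {R : realType}.

(** A supremum over finite sets of indices is not changed by discarding the
negative terms.  This is what makes the sums of the definitions measurable and
nonnegative everywhere, whatever version of the conditional expectation was
chosen. *)
Lemma esum_posE (I : choiceType) (D : set I) (a : I -> R) :
  \esum_(i in D) (a i)%:E = \esum_(i in D) (Num.max (a i) 0%R)%:E.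
Proof.
apply/eqP; rewrite eq_le; apply/andP; split.
  by apply: le_esum => i _; rewrite lee_fin le_max lexx.
apply: (@le_trans _ _ (\esum_(i in D `&` [set i | (0 <= a i)%R]) (a i)%:E)).
  rewrite esum_mkcondr; apply: le_esum => i _.
  case: ifPn => ai.
    by rewrite max_l//; move: ai; rewrite inE.
  rewrite max_r//; rewrite notin_setE /= in ai.
  by apply/ltW; rewrite ltNge; apply/negP.
apply: ge_ereal_sup => _ [A [Afin AD] <-]; apply: esum_ge; exists A => //.
by split=> // i /AD[].
Qed.

Definition int_of_index (k : nat) : int := if odd k then Negz k./2 else Posz k./2.

Lemma int_of_index_bij : set_bij [set: nat] [set: int] int_of_index.
Proof.
split=> //.
- move=> k l _ _; rewrite /int_of_index => kl.
  rewrite -[k]odd_double_half -[l]odd_double_half.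
  by move: kl; case: (odd k); case: (odd l) => // -[->].
- move=> [n|n] _ /=.
    by exists n.*2 => //; rewrite /int_of_index odd_double doubleK.
  exists n.*2.+1 => //; rewrite /int_of_index /= odd_double /=.
  by rewrite uphalf_double.
Qed.

Lemma int_of_index_surj (i : int) : exists k, int_of_index k = i.
Proof. by have [_ _ /(_ i I)[k _ ki]] := int_of_index_bij; exists k. Qed.

Lemma esum_int_series (D : set int) (a : int -> \bar R) : (forall i, 0 <= a i) ->
  \esum_(i in D) a i =
  \sum_(k <oo) if int_of_index k \in D then a (int_of_index k) else 0.
Proof.
move=> a0; rewrite esum_mkcond.
rewrite (reindex_esum _ _ _ _ int_of_index_bij) nneseries_esumT//.
by move=> k; case: ifP.
Qed.

Lemma le_sum_uniq_subset (I : eqType) (s t : seq I) (a : I -> \bar R) :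
  (forall i, 0 <= a i) -> uniq s -> {subset s <= t} ->
  \sum_(i <- s) a i <= \sum_(i <- t) a i.
Proof.
move=> a0; elim: s t => [|x s ih] t /=; first by rewrite big_nil sume_ge0.
move=> /andP[xs us] st; have xt : x \in t by apply: st; rewrite mem_head.
rewrite big_cons (big_rem x xt)/= leeD2l//; apply: ih => // y ys.
apply: rem_mem; last by apply: st; rewrite in_cons ys orbT.
by apply: contraNneq xs => <-.
Qed.

(** A finite set of integers lies in a window i, i+1, ..., i+N. *)
Lemma esum_int_le (a : int -> \bar R) (B : \bar R) : (forall i, 0 <= a i) ->
  (forall (i : int) (N : nat), \sum_(n < N.+1) a (i + n%:Z)%R <= B) ->
  \esum_(i in [set: int]) a i <= B.
Proof.
move=> a0 aB; apply: ge_ereal_sup => _ [A [Afin _] <-].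
rewrite fsbig_finite//; set s := fset_set A.
pose M := (\sum_(i <- s) `|i|)%N.
have sM i : i \in s -> (`|i| <= M)%N.
  by move=> si; rewrite /M (big_rem i si) leq_addr.
apply: (le_trans _ (aB (- M%:Z)%R (M + M)%N)).
rewrite -(big_mkord xpredT (fun n => a (- M%:Z + n%:Z)%R)).
rewrite -(big_map (fun n : nat => (- M%:Z + n%:Z)%R) xpredT a).
apply: le_sum_uniq_subset => //.
move=> i /sM iM; apply/mapP; exists `|(M%:Z + i)%R|%N.
  by rewrite mem_index_iota; lia.
lia.
Qed.

End esum_of_integers.

Section integral_of_esum.
Context {d : measure_display} {T : measurableType d} {R : realType}.
Variable mu : {measure set T -> \bar R}.
Variables (D : set int) (a : int -> T -> R).
Hypothesis na : forall i, nnm (a i).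

Let term (k : nat) (x : T) : \bar R :=
  if int_of_index k \in D then (a (int_of_index k) x)%:E else 0.

Let term_ge0 k x : 0 <= term k x.
Proof. by rewrite /term; case: ifP => // _; rewrite lee_fin (na _).2. Qed.

Let mterm k : measurable_fun [set: T] (term k).
Proof.
rewrite /term; case: (int_of_index k \in D); last exact: measurable_cst.
by apply/measurable_EFinP; exact: (na _).1.
Qed.

Let termE : (fun x => \esum_(i in D) (a i x)%:E) = (fun x => \sum_(k <oo) term k x).
Proof.
by apply/funext => x; rewrite esum_int_series// => i; rewrite lee_fin (na i).2.
Qed.

Lemma measurable_esum : measurable_fun [set: T] (fun x => \esum_(i in D) (a i x)%:E).
Proof.
rewrite termE; apply: ge0_emeasurable_sum => [k x _ _|k _]; first exact: term_ge0.
exact: mterm.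
Qed.

Lemma integral_esum : \int[mu]_x (\esum_(i in D) (a i x)%:E) =
  \esum_(i in D) \int[mu]_x (a i x)%:E.
Proof.
rewrite termE integral_nneseries// esum_int_series; last first.
  by move=> i; exact: int_ge0.
apply: eq_eseriesr => k _; rewrite /term; case: (int_of_index k \in D) => //.
exact: integral0.
Qed.

End integral_of_esum.

Section norm_of_the_form.
Context {d : measure_display} {T : measurableType d} {R : realType}.
Variable mu : {sigma_finite_measure set T -> \bar R}.
Variable F : int -> set (set T).
Hypothesis filtF : sigma_finite_filtration mu F.
Variable alpha : int -> T -> R.
Hypothesis admF : admissible_coefficients F alpha.

Lemma admissible_nnm i : nnm_wrt (F i) (alpha i).
Proof. by have [] := admF i; split. Qed.

Lemma nnm_cond_exp i (k : T -> R) : weight mu F k -> nnm (nonneg_cond_exp mu F i k).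
Proof. by move=> wk; exact: (nnm_sub (filtration_sub filtF i) (nonneg_cond_expP filtF i wk).1). Qed.

Lemma esum_cond_exp (D : set int) (u : T -> R) x :
  \esum_(j in D) (cond_exp mu F j u x * alpha j x)%:E =
  \esum_(j in D) (nonneg_cond_exp mu F j u x * alpha j x)%:E.
Proof.
rewrite [LHS]esum_posE; apply: eq_esum => j _.
by rewrite /nonneg_cond_exp maxr_pMl ?mul0r//; have [] := admF j.
Qed.

(** The versions of conditional expectations in [bilinear_op] agree with their
nonnegative modifications outside one negligible set, the indices being
countable. *)
Lemma Lnorm_bilinear_op (u v : T -> R) : weight mu F u -> weight mu F v ->
  'N[mu]_1 [bilinear_op mu F alpha u v] =
  \esum_(i in [set: int]) \int[mu]_x
    (alpha i x * nonneg_cond_exp mu F i u x * nonneg_cond_exp mu F i v x)%:E.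
Proof.
move=> wu wv.
have Fm i := filtration_sub filtF i.
pose b i x : R := (alpha i x * cond_exp mu F i u x * cond_exp mu F i v x)%R.
pose c i x : R := (alpha i x * nonneg_cond_exp mu F i u x * nonneg_cond_exp mu F i v x)%R.
have nc i : nnm (c i).
  apply: nnm_mul (nnm_cond_exp i wv); apply: nnm_mul (nnm_cond_exp i wu).
  exact: (nnm_sub (Fm i) (admissible_nnm i)).
have mce i k : weight mu F k -> measurable_fun [set: T] (cond_exp mu F i k).
  by move=> wk; exact: measurable_wrt_sub (Fm i) _ (cond_exp_ae filtF i wk).1.
have nb i : nnm (fun x => Num.max (b i x) 0%R).
  split=> [|x]; last by rewrite le_max lexx orbT.
  apply: measurable_maxr; last exact: measurable_cst.
  apply: measurable_funM (mce i v wv); apply: measurable_funM (mce i u wu).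
  exact: (nnm_sub (Fm i) (admissible_nnm i)).1.
rewrite Lnorm1 -(integral_esum mu _ nc).
rewrite (eq_integral (fun x => \esum_(i in [set: int]) (Num.max (b i x) 0%R)%:E)); last first.
  move=> x _; rewrite /bilinear_op esum_posE gee0_abs//.
  by apply: esum_ge0 => i _; rewrite lee_fin (nb i).2.
apply: ge0_ae_eq_integral => //.
- exact: (measurable_esum _ nb).
- exact: (measurable_esum _ nc).
- by move=> x _; apply: esum_ge0 => i _; rewrite lee_fin (nb i).2.
- by move=> x _; apply: esum_ge0 => i _; rewrite lee_fin (nc i).2.
have ae_eq_ce k : weight mu F k -> {ae mu, forall x, forall n,
    cond_exp mu F (int_of_index n) k x = nonneg_cond_exp mu F (int_of_index n) k x}.
  by move=> wk; apply: ae_foralln => n; exact: cond_exp_eq_nonneg.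
move: (ae_eq_ce u wu) (ae_eq_ce v wv); apply: filterS2 => x eu ev _.
apply: eq_esum => i _; congr EFin; have [n <-] := int_of_index_surj i.
by rewrite /b eu ev max_l//; exact: (nc (int_of_index n)).2.
Qed.

End norm_of_the_form.

(** * Weighted spaces and localization of the tests *)
Lemma esum_ge_uniq {R : realType} (I : choiceType) (D : set I) (a : I -> \bar R)
    (s : seq I) : uniq s -> (forall i, i \in s -> D i) ->
  \sum_(i <- s) a i <= \esum_(i in D) a i.
Proof.
move=> us sD; apply: esum_ge; exists [set` s]; last by rewrite fsbig_seq.
by split=> [|i /= /sD]; first exact: finite_seq.
Qed.

Section weighted_spaces.
Context {d : measure_display} {T : measurableType d} {R : realType}.
Variable mu : {sigma_finite_measure set T -> \bar R}.
Variable F : int -> set (set T).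
Hypothesis filtF : sigma_finite_filtration mu F.

Lemma weighted_LnormE (p : R) (w f : T -> R) : (forall x, (0 <= f x)%R) ->
  weighted_Lnorm mu p w f = (\int[mu]_x (f x `^ p * w x)%:E) `^ p^-1.
Proof.
move=> f0; congr (_ `^ _); apply: eq_integral => x _.
by rewrite ger0_norm.
Qed.

Lemma weighted_Lspace_norm (p : R) (w f : T -> R) : (0 < p)%R -> nnm w ->
  (forall x, (0 <= f x)%R) -> weighted_Lspace mu p w f ->
  exists a : R, [/\ (0 <= a)%R, weighted_Lnorm mu p w f = a%:E &
    \int[mu]_x (f x `^ p * w x)%:E = (a `^ p)%:E].
Proof.
move=> p0 nw f0 [mf]; rewrite weighted_LnormE// => fin.
have pn0 : (p != 0)%R by rewrite gt_eqF.
have I0 : 0 <= \int[mu]_x (f x `^ p * w x)%:E.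
  by apply: int_ge0; apply: nnm_mul nw; apply: nnm_powR; split.
have N0 := poweR_ge0 (\int[mu]_x (f x `^ p * w x)%:E) p^-1.
exists (fine ((\int[mu]_x (f x `^ p * w x)%:E) `^ p^-1)); split.
- exact: fine_ge0.
- by rewrite fineK// ge0_fin_numE.
- rewrite -poweR_EFin fineK ?ge0_fin_numE//.
  by rewrite -poweRrM mulVf// poweRe1.
Qed.

(** Local integrability comes from f <= 1 + f^p. *)
Lemma weight_mul (p : R) (w f : T -> R) : (1 < p)%R -> weight mu F w ->
  (forall x, (0 <= f x)%R) -> weighted_Lspace mu p w f ->
  weight mu F (f \* w)%R.
Proof.
move=> p1 ww f0 fL; have nw := weight_nnm ww.
have p0 : (0 < p)%R by exact: lt_trans p1.
have [a [a0 _ Ia]] := weighted_Lspace_norm p0 nw f0 fL.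
have nf : nnm f by split=> //; exact: fL.1.
have nfw : nnm (fun x => f x * w x)%R by exact: nnm_mul.
split; last by move=> x; exact: nfw.2.
split; first exact: nfw.1.
move=> i E [FE Efin].
have mE : measurable E by exact: (filtration_sub filtF i).
apply/integrableP; split.
  by apply: measurable_funTS; apply/measurable_EFinP; exact: nfw.1.
under eq_integral do rewrite gee0_abs ?lee_fin ?nfw.2//.
have wE := int_lty ww FE Efin.
have nE : nnm (\1_E : T -> R) by exact: nnm_indic.
have nfp : nnm (fun x => f x `^ p * w x)%R := nnm_mul (nnm_powR p nf) nw.
rewrite [ltLHS]int_indic//; apply: (@le_lt_trans _ _
    (\int[mu]_x (\1_E x * w x + f x `^ p * w x)%:E)).
  apply: le_int; [exact: nnm_mul|exact: nnm_add (nnm_mul nE nw) nfp|].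
  move=> x; rewrite -mulrDl [(f \* w)%R x]/(f x * w x)%R mulrA ler_wpM2r ?nw.2//.
  rewrite indicE; case: (x \in E); last by rewrite mul0r add0r powR_ge0.
  rewrite mul1r; have [f1|f1] := leP (f x) 1%R.
    by apply: (le_trans f1); rewrite lerDl powR_ge0.
  apply: (@le_trans _ _ (f x `^ p)%R); last by rewrite lerDr.
  by apply: le1r_powR; exact: ltW.
rewrite intD//; last exact: nnm_mul.
by rewrite -int_indic// lte_add_pinfty// Ia ltry.
Qed.

End weighted_spaces.

Section sufficiency.
Context {d : measure_display} {T : measurableType d} {R : realType}.
Variable mu : {sigma_finite_measure set T -> \bar R}.
Variable F : int -> set (set T).
Hypothesis filtF : sigma_finite_filtration mu F.
Variable alpha : int -> T -> R.
Hypothesis admF : admissible_coefficients F alpha.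

Let Fm i : F i `<=` measurable := filtration_sub filtF i.

(** For E in F_(i+m), the test is applied to the intersection of E with E0, a set
of F_(i+m) of finite measure; the window is a part of the sum over all
indices from i+m on. *)
Lemma testing_bound_cut (s r C : R) (u v : T -> R) (i : int) (E0 : set T) :
  (0 < s)%R -> (0 < r)%R -> (0 <= C)%R -> weight mu F u -> weight mu F v ->
  testing_bound mu F alpha s r u v C -> F i E0 -> mu E0 < +oo ->
  forall (N m : nat) (E : set T), (F (i + m%:Z)%R).-sigma.-measurable E ->
  \int[mu]_(x in E) ((\sum_(j < N.+1 | (m <= j)%N)
      (\1_E0 x * nonneg_cond_exp mu F (i + j%:Z)%R u x) * alpha (i + j%:Z)%R x) `^ r *
      (\1_E0 x * v x))%:E <=
  (C `^ r)%:E * (\int[mu]_(x in E) (\1_E0 x * u x)%:E) `^ (r / s).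
Proof.
move=> s0 r0 C0 wu wv test FE0 E0fin N m E.
rewrite (filtration_sigmaE filtF) => FE.
have mE0 : measurable E0 by exact: Fm FE0.
have mE : measurable E by exact: Fm FE.
have FE' : F (i + m%:Z)%R (E `&` E0).
  have FmE0 : F (i + m%:Z)%R E0.
    have [->|m0] := eqVneq m 0%N; first by rewrite addr0.
    apply: (filtration_nondecreasing filtF _ FE0).
    by rewrite ltrDl ltz_nat lt0n.
  move: FE FmE0; rewrite -(filtration_sigmaE filtF); exact: measurableI.
have mE' : measurable (E `&` E0) by exact: measurableI.
have E'fin : mu (E `&` E0) < +oo.
  apply: le_lt_trans E0fin; apply: le_measure; rewrite ?inE//.
have nu := weight_nnm wu; have nv := weight_nnm wv.
pose a j x : R := (nonneg_cond_exp mu F j u x * alpha j x)%R.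
have na j : nnm (a j).
  exact: nnm_mul (nnm_cond_exp filtF j wu) (nnm_sub (Fm (i:=j)) (admissible_nnm admF j)).
set D := [set j : int | (i + m%:Z <= j)%R].
pose X := \int[mu]_(x in E `&` E0) ((\esum_(j in D) (a j x)%:E) `^ r * (v x)%:E).
pose Y := weight_set mu u (E `&` E0).
have XY : X `^ r^-1 <= C%:E * Y `^ s^-1.
  rewrite /X; under eq_integral do rewrite -(esum_cond_exp mu admF).
  exact: test _ _ (conj FE' E'fin).
have X0 : 0 <= X.
  apply: integral_ge0 => x _; apply: mule_ge0; first exact: poweR_ge0.
  by rewrite lee_fin nv.2.
have Y0 : 0 <= Y by apply: integral_ge0 => x _; rewrite lee_fin nu.2.
have XY' : X <= (C `^ r)%:E * Y `^ (r / s).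
  have := le_poweR (ltW r0) (poweR_ge0 _ _) XY.
  rewrite -poweRrM mulVf ?gt_eqF// poweRe1// poweRM//; last exact: poweR_ge0.
  by rewrite poweR_EFin -poweRrM [(s^-1 * r)%R]mulrC.
have YE : \int[mu]_(x in E) (\1_E0 x * u x)%:E = Y.
  rewrite /Y /weight_set [RHS]int_indic// int_indic//.
  by apply: eq_integral => x _; rewrite indicI /= mulrA.
rewrite YE; apply: le_trans XY'.
rewrite [leLHS]int_indic//.
have nE : nnm (\1_E : T -> R) by exact: nnm_indic.
have nE0 : nnm (\1_E0 : T -> R) by exact: nnm_indic.
rewrite /X [leRHS]integral_mkcond; apply: ge0_le_integral => //.
- move=> x _; rewrite lee_fin; apply: mulr_ge0; first exact: nE.2.
  by apply: mulr_ge0; [exact: powR_ge0|apply: mulr_ge0; [exact: nE0.2|exact: nv.2]].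
- apply/measurable_EFinP; apply: (nnm_mul nE _).1; apply: nnm_mul (nnm_mul nE0 nv).
  apply: nnm_powR; apply: (@nnm_sum _ T R _ (index_enum 'I_N.+1) (fun j => (m <= j)%N)
    (fun (j : 'I_N.+1) x => (\1_E0 x * nonneg_cond_exp mu F (i + j%:Z)%R u x) *
      alpha (i + j%:Z)%R x)%R) => j _.
  apply: nnm_mul; first exact: nnm_mul nE0 (nnm_cond_exp filtF _ wu).
  exact: (nnm_sub (Fm (i:=_)) (admissible_nnm admF _)).
- apply/(measurable_restrict _ _ _).1 => //; rewrite ?setTI//.
  apply: measurable_funTS; apply: emeasurable_funM.
    apply: (measurableT_comp (measurable_poweR r)); exact: measurable_esum.
  by apply/measurable_EFinP; exact: nv.1.
move=> x _; rewrite patchE in_setI; rewrite !indicE.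
case: (x \in E); last by rewrite mul0r.
case: (x \in E0); last by rewrite mul0r mulr0 mulr0.
rewrite /= !mul1r EFinM; apply: lee_wpmul2r; first by rewrite lee_fin nv.2.
rewrite -poweR_EFin; apply: le_poweR; first exact: ltW.
  rewrite lee_fin; apply: sumr_ge0 => j _; rewrite mul1r.
  exact: (na _).2.
rewrite -sumEFin.
rewrite (eq_bigr (fun j : 'I_N.+1 => (a (i + j%:Z)%R x)%:E)); last first.
  by move=> j _; rewrite mul1r.
rewrite -(big_mkord (fun j => (m <= j)%N) (fun j => (a (i + j%:Z)%R x)%:E)).
rewrite -big_filter -(big_map (fun j : nat => (i + j%:Z)%R) xpredT (fun k => (a k x)%:E)).
apply: esum_ge_uniq.
  rewrite map_inj_uniq; first by rewrite filter_uniq// iota_uniq.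
  by move=> j k /addrI [].
move=> k /mapP[j]; rewrite mem_filter => /andP[mj _] ->.
by rewrite /D /= lerD2l lez_nat.
Qed.

End sufficiency.

(** * The tests imply the bound on the form *)
Definition form_constant {R : realType} (p q p' q' : R) : R :=
  (half_constant p q p' q' + half_constant q' p' q p)%R.

Section sufficiency_of_testing.
Context {d : measure_display} {T : measurableType d} {R : realType}.
Variable mu : {sigma_finite_measure set T -> \bar R}.
Variable F : int -> set (set T).
Hypothesis filtF : sigma_finite_filtration mu F.
Variable alpha : int -> T -> R.
Hypothesis admF : admissible_coefficients F alpha.

Lemma filtration_exhaustion i : exists Om : nat -> set T,
  [/\ [set: T] = \bigcup_k Om k, forall k l, (k <= l)%N -> Om k `<=` Om l,
      forall k, F i (Om k) & forall k, mu (Om k) < +oo].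
Proof.
have sf := filtration_sigma_finite filtF i.
have /sigma_finiteP[Om [OmT ndOm finOm]] : sigma_finite [set: g_sigma_algebraType (F i)]
  (trace_measure (filtration_sub filtF i) sf) := sf.
exists Om; split => //.
- by move=> k l kl; exact/subsetPset/ndOm.
- by move=> k; rewrite -(filtration_sigmaE filtF); exact: (finOm k).1.
- by move=> k; exact: (finOm k).2.
Qed.

Lemma filtration_le i j : (i <= j)%R -> F i `<=` F j.
Proof.
rewrite le_eqVlt => /orP[/eqP -> //|]; exact: (filtration_nondecreasing filtF).
Qed.

Theorem bilinear_bound_of_testing (p q p' q' C1 C2 : R) (sigma omega : T -> R) :
  (1 < p)%R -> (p <= q)%R -> (p^-1 + p'^-1 = 1)%R -> (q^-1 + q'^-1 = 1)%R ->
  (0 <= C1)%R -> (0 <= C2)%R -> weight mu F sigma -> weight mu F omega ->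
  testing_bound mu F alpha p q sigma omega C1 ->
  testing_bound mu F alpha q' p' omega sigma C2 ->
  bilinear_bound mu F alpha p q' sigma omega (form_constant p q p' q' * (C1 + C2))%R.
Proof.
move=> p1 pq pp' qq' C10 C20 wS wO test1 test2 f g f0 fL g0 gL.
have q1 : (1 < q)%R by exact: lt_le_trans pq.
have p'1 := conjugate_gt1 p1 pp'; have q'1 := conjugate_gt1 q1 qq'.
have gt0 (e : R) : (1 < e)%R -> (0 < e)%R by exact: lt_trans.
have nS := weight_nnm wS; have nO := weight_nnm wO.
have [a [a0 -> fa]] := weighted_Lspace_norm (gt0 p p1) nS f0 fL.
have [b [b0 -> gb]] := weighted_Lspace_norm (gt0 q' q'1) nO g0 gL.
have wf := weight_mul filtF p1 wS f0 fL; have wg := weight_mul filtF q'1 wO g0 gL.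
have nf : nnm f by split=> //; exact: fL.1.
have ng : nnm g by split=> //; exact: gL.1.
rewrite (Lnorm_bilinear_op filtF admF)// -!EFinM.
have nal i : nnm (alpha i).
  exact: nnm_sub (filtration_sub filtF i) _ (admissible_nnm admF i).
have nterm i : nnm (fun x => alpha i x * nonneg_cond_exp mu F i (f \* sigma)%R x *
    nonneg_cond_exp mu F i (g \* omega)%R x)%R.
  exact: nnm_mul (nnm_mul (nal i) (nnm_cond_exp filtF i wf)) (nnm_cond_exp filtF i wg).
apply: esum_int_le => [i|i N]; first exact: int_ge0.
pose term (n : 'I_N.+1) x : R := (alpha (i + n%:Z)%R x *
  nonneg_cond_exp mu F (i + n%:Z)%R (f \* sigma)%R x *
  nonneg_cond_exp mu F (i + n%:Z)%R (g \* omega)%R x)%R.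
pose tot x : R := (\sum_(n < N.+1) term n x)%R.
have ntot : nnm tot.
  exact: (@nnm_sum _ T R _ (index_enum 'I_N.+1) xpredT term) (fun n _ => nterm _).
rewrite [leLHS](_ : _ = \int[mu]_x (tot x)%:E); last first.
  by rewrite int_sum// => n; exact: nterm.
have [Om [OmT ndOm FOm Omfin]] := filtration_exhaustion i.
have mOm k : measurable (Om k) by exact: (filtration_sub filtF i).
have nOm k : nnm (\1_(Om k) : T -> R) by exact: nnm_indic.
apply: (le_int_exhaustion ntot mOm ndOm OmT).
move=> k; set E0 := Om k.
pose G n := F (i + n%:Z)%R.
have Gm n : G n `<=` measurable := filtration_sub filtF _.
have Gnd n m : (n <= m)%N -> G n `<=` G m.
  by move=> nm; apply: filtration_le; rewrite lerD2l lez_nat.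
have mE0 n : (G n).-sigma.-measurable E0.
  rewrite /G (filtration_sigmaE filtF); apply: (filtration_le _ (FOm k)).
  by rewrite lerDl.
have nE0 : nnm (\1_E0 : T -> R) by exact: nOm.
have cut_fin u : weight mu F u -> \int[mu]_x (\1_E0 x * u x)%:E < +oo.
  by move=> wu; have := int_lty wu (FOm k) (Omfin k); rewrite int_indic.
have cut_le (u h : T -> R) e : nnm u -> nnm h ->
    \int[mu]_x (h x `^ e * (\1_E0 x * u x))%:E <= \int[mu]_x (h x `^ e * u x)%:E.
  move=> nu nh; apply: le_int.
  - exact: nnm_mul (nnm_powR e nh) (nnm_mul nE0 nu).
  - exact: nnm_mul (nnm_powR e nh) nu.
  - move=> x; apply: ler_wpM2l; first exact: powR_ge0.
    by rewrite ler_piMl ?nu.2// indicE lern1 leq_b1.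
have versions (h u : T -> R) n : weight mu F (h \* u)%R ->
    cond_version mu (G n) (fun x => h x * (\1_E0 x * u x))%R
      (fun x => \1_E0 x * nonneg_cond_exp mu F (i + n%:Z)%R (h \* u)%R x)%R.
  move=> whu; have := cond_version_indic (mE0 n) (nonneg_cond_expP filtF (i + n%:Z)%R whu).
  by congr (cond_version _ _ _ _); apply/funext => x /=; rewrite mulrCA.
have main := both_halves Gm Gnd p1 pq pp' qq' (nnm_mul nE0 nS) (cut_fin _ wS)
  (nnm_mul nE0 nO) (cut_fin _ wO) nf ng (fun n => admissible_nnm admF (i + n%:Z)%R)
  (fun n => cond_version_indic (mE0 n) (nonneg_cond_expP filtF (i + n%:Z)%R wS))
  (fun n => cond_version_indic (mE0 n) (nonneg_cond_expP filtF (i + n%:Z)%R wO))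
  (fun n => versions f sigma n wf) (fun n => versions g omega n wg) C10 C20
  (testing_bound_cut filtF admF (gt0 p p1) (gt0 q q1) C10 wS wO test1 (FOm k) (Omfin k) N)
  (testing_bound_cut filtF admF (gt0 q' q'1) (gt0 p' p'1) C20 wO wS test2 (FOm k) (Omfin k) N)
  a0 b0.
apply: (@le_trans _ _ (\sum_(n < N.+1) \int[mu]_x (alpha (i + n%:Z)%R x *
    (\1_E0 x * nonneg_cond_exp mu F (i + n%:Z)%R (f \* sigma)%R x) *
    (\1_E0 x * nonneg_cond_exp mu F (i + n%:Z)%R (g \* omega)%R x))%:E)).
  rewrite -int_sum; last first.
    move=> n; apply: nnm_mul (nnm_mul nE0 (nnm_cond_exp filtF _ wg)).
    exact: nnm_mul (nal _) (nnm_mul nE0 (nnm_cond_exp filtF _ wf)).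
  rewrite le_eqVlt; apply/orP; left; apply/eqP; apply: eq_integral => x _; congr EFin.
  rewrite /tot mulr_sumr; apply: eq_bigr => n _; rewrite indicE.
  by case: (x \in E0); rewrite ?mul1r ?mul0r ?mulr0 ?mul0r.
apply: (le_trans (main _ _)).
- by rewrite -fa; exact: cut_le.
- by rewrite -gb; exact: cut_le.
rewrite lee_fin /form_constant.
have h1 := half_constant_ge0 p1 q1 pp' qq'.
have h2 : (0 <= half_constant q' p' q p)%R.
  by apply: half_constant_ge0 => //; rewrite addrC.
set x := half_constant p q p' q' in h1 *; set y := half_constant q' p' q p in h2 *.
have ab : (0 <= a * b)%R by exact: mulr_ge0.
have -> : (x * (C1 * a) * b + y * (C2 * b) * a = (x * C1 + y * C2) * (a * b))%R by ring.
have -> : ((x + y) * (C1 + C2) * a * b = ((x + y) * (C1 + C2)) * (a * b))%R by ring.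
by apply: ler_wpM2r => //; exact: ler_sum_mul.
Qed.

End sufficiency_of_testing.

(** * The bound on the form implies the tests *)
Lemma esum_scale {R : realType} (D : set int) (a : int -> R) (c : R) :
  (forall i, (0 <= a i)%R) -> (0 <= c)%R ->
  c%:E * (\esum_(i in D) (a i)%:E) = \esum_(i in D) (a i * c)%:E.
Proof.
move=> a0 c0; rewrite !esum_int_series; last 2 first.
- by move=> i; rewrite lee_fin mulr_ge0.
- by move=> i; rewrite lee_fin.
rewrite -nneseriesZl; last by move=> k _; case: ifP => // _; rewrite lee_fin.
apply: eq_eseriesr => k _; case: ifP => _; last by rewrite mule0.
by rewrite -EFinM mulrC.
Qed.

(** Finiteness of [X] is what allows the division by its power. *)
Lemma poweR_cancel {R : realType} (q r : R) (X Y : \bar R) :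
  (1 < q)%R -> (q^-1 + r^-1 = 1)%R -> 0 <= X -> X < +oo -> 0 <= Y ->
  X <= Y * X `^ r^-1 -> X <= Y `^ q.
Proof.
move=> q1 qr; have r1 := conjugate_gt1 q1 qr.
have q0 : (0 < q)%R by exact: lt_trans q1.
case: X => [X| |]//; rewrite lee_fin => X0 _.
have [->|Xn0] := eqVneq X 0%R; first by rewrite poweR_ge0.
have Xgt0 : (0 < X)%R by rewrite lt_neqAle eq_sym Xn0.
case: Y => [Y| |]//; last by move=> _ _; rewrite poweRyr ?leey// gt_eqF.
rewrite !poweR_EFin -EFinM !lee_fin => Y0 XY.
have w0 : (0 < X `^ r^-1)%R by exact: powR_gt0.
have XE : (X = X `^ q^-1 * X `^ r^-1)%R.
  have h : (q^-1 + r^-1 == 0)%R ==> (X != 0)%R by rewrite Xn0 implybT.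
  by rewrite -(powRD h) qr powRr1.
have : (X `^ q^-1 <= Y)%R.
  by rewrite -(ler_pM2r w0) -XE.
move=> /(le_powR (ltW q0) (powR_ge0 _ _)).
by rewrite -powRrM mulVf ?gt_eqF// powRr1.
Qed.

Section necessity_of_testing.
Context {d : measure_display} {T : measurableType d} {R : realType}.
Variable mu : {sigma_finite_measure set T -> \bar R}.
Variable F : int -> set (set T).
Hypothesis filtF : sigma_finite_filtration mu F.
Variable alpha : int -> T -> R.
Hypothesis admF : admissible_coefficients F alpha.

Let Fm i : F i `<=` measurable := filtration_sub filtF i.

Let nal i : nnm (alpha i).
Proof. exact: nnm_sub (filtration_sub filtF i) _ (admissible_nnm admF i). Qed.

Let a (u : T -> R) j x : R := (nonneg_cond_exp mu F j u x * alpha j x)%R.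

Let na u j : weight mu F u -> nnm (a u j).
Proof. by move=> wu; exact: nnm_mul (nnm_cond_exp filtF j wu) (nal j). Qed.

(** E is F_j-measurable for j >= i, so the indicator can be moved from the
argument of one conditional expectation to the other factor. *)
Lemma int_localized (sigma k : T -> R) (i j : int) (E : set T) :
  weight mu F sigma -> (i <= j)%R -> F i E ->
  weight mu F (\1_E \* sigma)%R -> weight mu F k ->
  \int[mu]_x (alpha j x * nonneg_cond_exp mu F j (\1_E \* sigma)%R x *
              nonneg_cond_exp mu F j k x)%:E =
  \int[mu]_x (a sigma j x * (\1_E x * k x))%:E.
Proof.
move=> wS ij FE wES wk.
have FjE : (F j).-sigma.-measurable E.
  by rewrite (filtration_sigmaE filtF); exact: (filtration_le filtF ij FE).
have nE : nnm_wrt (F j) (\1_E : T -> R) by exact: nnm_indic.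
have [nk kP] := nonneg_cond_expP filtF j wk.
have [ns sP] := nonneg_cond_expP filtF j wS.
have [_ EsP] := nonneg_cond_expP filtF j wES.
have nalj := admissible_nnm admF j.
transitivity (\int[mu]_x ((alpha j x * nonneg_cond_exp mu F j k x) *
    nonneg_cond_exp mu F j (\1_E \* sigma)%R x)%:E).
  by apply: eq_integral => x _; rewrite mulrAC.
rewrite -EsP; last exact: nnm_mul nalj nk.
transitivity (\int[mu]_x ((alpha j x * nonneg_cond_exp mu F j k x * \1_E x) *
    sigma x)%:E).
  by apply: eq_integral => x _; rewrite /= !mulrA.
rewrite sP; last exact: nnm_mul (nnm_mul nalj nk) nE.
transitivity (\int[mu]_x ((nonneg_cond_exp mu F j sigma x * alpha j x * \1_E x) *
    nonneg_cond_exp mu F j k x)%:E).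
  by apply: eq_integral => x _; congr EFin; ring.
rewrite -kP; last exact: nnm_mul (nnm_mul ns nalj) nE.
by apply: eq_integral => x _; rewrite -mulrA.
Qed.

(** The extremal function g = 1_E S^(q-1) is truncated, both to make it
real-valued and to make the integral to be cancelled finite. *)
Theorem testing_bound_of_bilinear (p q q' C : R) (sigma omega : T -> R) :
  (1 < p)%R -> (1 < q)%R -> (q^-1 + q'^-1 = 1)%R -> (0 <= C)%R ->
  weight mu F sigma -> weight mu F omega ->
  bilinear_bound mu F alpha p q' sigma omega C ->
  testing_bound mu F alpha p q sigma omega C.
Proof.
move=> p1 q1 qq' C0 wS wO boundA i E [FE Efin].
have p0 : (0 < p)%R by exact: lt_trans p1.
have q0 : (0 < q)%R by exact: lt_trans q1.
have q'1 := conjugate_gt1 q1 qq'.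
have q'0 : (0 < q')%R by exact: lt_trans q'1.
have nS := weight_nnm wS; have nO := weight_nnm wO.
have mE : measurable E by exact: Fm FE.
have nE : nnm (\1_E : T -> R) by exact: nnm_indic.
set D := [set j : int | (i <= j)%R].
pose S x : \bar R := \esum_(j in D) (a sigma j x)%:E.
have S0 x : 0 <= S x by apply: esum_ge0 => j _; rewrite lee_fin; exact: (na j wS).2.
have mS : measurable_fun [set: T] S.
  by apply: measurable_esum => j; exact: na.
under eq_integral do rewrite (esum_cond_exp mu admF).
rewrite -/(S _).
set W := weight_set mu sigma E.
have W0 : 0 <= W by apply: integral_ge0 => x _; rewrite lee_fin nS.2.
have WE : W = \int[mu]_x (\1_E x * sigma x)%:E by rewrite /W /weight_set int_indic.
have Wfin : W < +oo by exact: int_lty wS FE Efin.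
pose Y := C%:E * W `^ p^-1.
have Y0 : 0 <= Y by apply: mule_ge0; rewrite ?poweR_ge0.
have indicX (e : R) x : (0 < e)%R -> ((\1_E x : R) `^ e = \1_E x)%R.
  move=> e0; rewrite indicE; case: (x \in E); first by rewrite powR1.
  by rewrite powR0// gt_eqF.
pose s (n : nat) x : R := fine (mine (S x) n%:R%:E).
have s_fin n x : mine (S x) n%:R%:E \is a fin_num.
  rewrite ge0_fin_numE; last by rewrite le_min S0 lee_fin ler0n.
  by rewrite gt_min ltry orbT.
have sE n x : (s n x)%:E = mine (S x) n%:R%:E by rewrite /s fineK.
have sS n x : (s n x)%:E <= S x by rewrite sE ge_min lexx.
have s_le n x : (s n x <= n%:R)%R by rewrite -lee_fin sE ge_min lexx orbT.
have ns n : nnm (s n).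
  split=> [|x]; last by rewrite -lee_fin sE le_min S0 lee_fin ler0n.
  apply: (@measurableT_comp _ _ _ _ _ _ (fine : \bar R -> R)); first exact: fine_measurable.
  by apply: measurable_mine => //; exact: measurable_cst.
have nds x n m : (n <= m)%N -> (s n x <= s m x)%R.
  move=> nm; rewrite -lee_fin !sE le_min !ge_min lexx/=.
  by rewrite lee_fin ler_nat nm orbT.
pose X n x : R := (\1_E x * (s n x `^ q * omega x))%R.
have nX n : nnm (X n) := nnm_mul nE (nnm_mul (nnm_powR q (ns n)) nO).
have fL : weighted_Lspace mu p sigma \1_E.
  split; first exact: nE.1.
  rewrite weighted_LnormE; last exact: nE.2.
  apply: poweR_lty; under eq_integral do rewrite indicX//.
  by rewrite -WE.
have fN : weighted_Lnorm mu p sigma \1_E = W `^ p^-1.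
  rewrite weighted_LnormE; last exact: nE.2.
  by under eq_integral do rewrite indicX//; rewrite -WE.
have wES : weight mu F (\1_E \* sigma)%R by apply: (weight_mul filtF p1) => //; exact: nE.2.
have XY n : \int[mu]_x (X n x)%:E <= Y `^ q.
  have Xfin : \int[mu]_x (X n x)%:E < +oo.
    have Ofin : \int[mu]_x (\1_E x * omega x)%:E < +oo.
      by have := int_lty wO FE Efin; rewrite int_indic.
    apply: (@le_lt_trans _ _ (\int[mu]_x (n%:R `^ q * (\1_E x * omega x))%:E)).
      apply: le_int => //.
        apply: nnm_mul (nnm_mul nE nO); apply: nnm_cst; exact: powR_ge0.
      move=> x; rewrite /X mulrCA ler_wpM2r//.
        by rewrite mulr_ge0 ?nE.2 ?nO.2.
      by apply: le_powR; [exact: ltW|exact: (ns n).2|].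
    rewrite intZ ?powR_ge0//; last exact: nnm_mul.
    by rewrite lte_mul_pinfty// lee_fin powR_ge0.
  (* The power (q - 1) q' = q makes the norm of g a power of the integral of
     X n, too. *)
  pose g x : R := (\1_E x * s n x `^ (q - 1))%R.
  have ng : nnm g by exact: nnm_mul nE (nnm_powR _ (ns n)).
  have gX : \int[mu]_x (g x `^ q' * omega x)%:E = \int[mu]_x (X n x)%:E.
    apply: eq_integral => x _; congr EFin.
    rewrite /g /X powRM ?nE.2 ?powR_ge0// indicX// -powRrM mulrA.
    rewrite (_ : (q - 1) * q' = q)%R//.
    have rE : (q'^-1 = 1 - q^-1)%R by rewrite -qq' addrAC subrr add0r.
    rewrite -[q']invrK rE.
    have qn1 : (q - 1 != 0)%R by rewrite subr_eq0 gt_eqF.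
    by field; rewrite gt_eqF// qn1.
  have gN : weighted_Lnorm mu q' omega g = (\int[mu]_x (X n x)%:E) `^ q'^-1.
    by rewrite weighted_LnormE ?gX//; exact: ng.2.
  have gL : weighted_Lspace mu q' omega g.
    by split; [exact: ng.1|rewrite gN poweR_lty].
  have wg : weight mu F (g \* omega)%R by apply: (weight_mul filtF q'1) => //; exact: ng.2.
  apply: (poweR_cancel q1 qq') => //; first exact: int_ge0.
  have := boundA \1_E g nE.2 fL ng.2 gL.
  rewrite fN gN -/Y; apply: le_trans.
  rewrite (Lnorm_bilinear_op filtF admF)//.
  apply: (@le_trans _ _ (\esum_(j in D) \int[mu]_x
      (a sigma j x * (\1_E x * (g x * omega x)))%:E)); last first.
    rewrite (eq_esum (fun j ij => esym (int_localized wS ij FE wES wg))).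
    apply: ge_ereal_sup => _ [A [Afin AD] <-].
    by apply: esum_ge; exists A.
  have nt j : nnm (fun x => a sigma j x * (\1_E x * (g x * omega x)))%R.
    exact: nnm_mul (na j wS) (nnm_mul nE (nnm_mul ng nO)).
  rewrite -(integral_esum mu _ nt); apply: ge0_le_integral => //.
  - by move=> x _; rewrite lee_fin; exact: (nX n).2.
  - by apply/measurable_EFinP; exact: (nX n).1.
  - exact: (measurable_esum _ nt).
  move=> x _; rewrite -esum_scale; last 2 first.
  - by move=> j; exact: (na j wS).2.
  - by apply: mulr_ge0; [exact: nE.2|apply: mulr_ge0; [exact: ng.2|exact: nO.2]].
  apply: le_trans (lee_wpmul2l _ (sS n x)); last first.
    by rewrite lee_fin; apply: mulr_ge0; [exact: nE.2|apply: mulr_ge0; [exact: ng.2|exact: nO.2]].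
  rewrite -EFinM lee_fin /X /g -(mulr_powRB1 ((ns n).2 x) q0).
  rewrite indicE; case: (x \in E); last by rewrite !mul0r.
  by rewrite !mul1r; rewrite le_eqVlt; apply/orP; left; apply/eqP; ring.
have ndX x n m : (n <= m)%N -> (X n x <= X m x)%R.
  move=> nm; rewrite /X ler_wpM2l ?nE.2// ler_wpM2r ?nO.2//.
  by apply: le_powR; [exact: ltW|exact: (ns n).2|exact: nds].
pose sup x := ereal_sup (range (fun n => (X n x)%:E)).
have cvX x : (X n x)%:E @[n --> \oo] --> sup x.
  by apply: ereal_nondecreasing_cvgn => n m nm; rewrite lee_fin; exact: ndX.
have le_sup n x : (X n x)%:E <= sup x by apply: ereal_sup_ubound; exists n.
have sup_ge x : ((fun x => S x `^ q * (omega x)%:E) \_ E) x <= sup x.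
  rewrite patchE; case: ifPn => xE; last first.
    by apply: le_trans (le_sup 0%N x); rewrite lee_fin; exact: (nX 0%N).2.
  have XE n : X n x = (s n x `^ q * omega x)%R by rewrite /X indicE xE mul1r.
  have := S0 x; have := sE ^~ x; case: (S x) => [r| |]// sEx r0.
    pose n := (Num.truncn r).+1.
    have snr : s n x = r.
      apply: EFin_inj; rewrite sEx; apply: min_l; rewrite lee_fin.
      by apply: ltW; exact: truncnS_gt.
    by apply: le_trans (le_sup n x); rewrite XE snr poweR_EFin -EFinM.
  have sn n : s n x = n%:R.
    by apply: EFin_inj; rewrite sEx; apply: min_r; exact: leey.
  have [->|O0] := eqVneq (omega x) 0%R.
    by rewrite mule0; apply: le_trans (le_sup 0%N x); rewrite lee_fin; exact: (nX 0%N).2.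
  have Ogt0 : (0 < omega x)%R by rewrite lt_neqAle eq_sym O0 nO.2.
  have : 0 <= sup x by apply: le_trans (le_sup 0%N x); rewrite lee_fin; exact: (nX 0%N).2.
  have := le_sup ^~ x; case: (sup x) => [L| |] leL; [|by move=> _; exact: leey|by []].
  rewrite lee_fin => L0; exfalso.
  pose n := (Num.truncn (L / omega x)).+1.
  have Ln : (L < n%:R * omega x)%R by rewrite -ltr_pdivrMr//; exact: truncnS_gt.
  have := leL n; rewrite lee_fin XE sn leNgt => /negP; apply.
  apply: (lt_le_trans Ln); rewrite ler_wpM2r ?nO.2//.
  by apply: le1r_powR; rewrite ?ler1n// ltW.
have key : \int[mu]_(x in E) (S x `^ q * (omega x)%:E) <= Y `^ q.
  apply: (@le_trans _ _ (\int[mu]_x limn (fun n => (X n x)%:E))).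
    rewrite integral_mkcond; apply: ge0_le_integral => //.
    - move=> x _; rewrite patchE; case: ifP => // _.
      by apply: mule_ge0; rewrite ?poweR_ge0// lee_fin nO.2.
    - apply/(measurable_restrict _ _ _).1 => //; rewrite ?setTI//.
      apply: measurable_funTS; apply: emeasurable_funM.
        exact: (measurableT_comp (measurable_poweR q) mS).
      by apply/measurable_EFinP; exact: nO.1.
    - apply: (emeasurable_fun_cvg (fun n x => (X n x)%:E)).
        by move=> n; apply/measurable_EFinP; exact: (nX n).1.
      by move=> x _; exact: (cvgP _ (cvX x)).
    by move=> x _; rewrite (cvg_lim _ (cvX x))//; exact: sup_ge.
  rewrite monotone_convergence//.
  - apply: lime_le; last exact: nearW.
    apply: ereal_nondecreasing_is_cvgn => n m nm; apply: le_int => // x.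
    exact: ndX.
  - by move=> n; apply/measurable_EFinP; exact: (nX n).1.
  - by move=> n x _; rewrite lee_fin; exact: (nX n).2.
  - by move=> x _ n m nm; rewrite lee_fin ndX.
have I0 : 0 <= \int[mu]_(x in E) (S x `^ q * (omega x)%:E).
  by apply: integral_ge0 => x _; apply: mule_ge0; rewrite ?poweR_ge0// lee_fin nO.2.
have qi0 : (0 <= q^-1)%R by rewrite invr_ge0 ltW.
have := le_poweR qi0 I0 key.
by rewrite -poweRrM mulfV ?gt_eqF// poweRe1.
Qed.

End necessity_of_testing.

(** * Degenerate weights, smallest constants and the theorem *)
Section degenerate_weights.
Context {d : measure_display} {T : measurableType d} {R : realType}.
Variable mu : {sigma_finite_measure set T -> \bar R}.
Variable F : int -> set (set T).
Hypothesis filtF : sigma_finite_filtration mu F.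
Variable alpha : int -> T -> R.
Hypothesis admF : admissible_coefficients F alpha.

(** Integration of E_0(v) <= C v over a set of F_0 of finite measure gives
v(E) <= C v(E) with v(E) finite. *)
Lemma A1_bound_lt1 (v : T -> R) (C : R) : weight mu F v -> (0 < C)%R -> (C < 1)%R ->
  A1_bound mu F v C -> {ae mu, forall x, v x = 0%R}.
Proof.
move=> wv C0 C1 vC; have nv := weight_nnm wv.
apply: int0_ae => //; apply/eqP; rewrite eq_le int_ge0// andbT.
have [Om [OmT ndOm FOm Omfin]] := filtration_exhaustion filtF 0.
have mOm k : measurable (Om k) by exact: (filtration_sub filtF 0).
have nOm k : nnm (\1_(Om k) : T -> R) by exact: nnm_indic.
apply: (le_int_exhaustion nv mOm ndOm OmT).
move=> k.
have [nc cP] := nonneg_cond_expP filtF 0 wv.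
have nc' := nnm_cond_exp filtF 0 wv.
have nOk : nnm_wrt (F 0) (\1_(Om k) : T -> R).
  by apply: nnm_indic; rewrite (filtration_sigmaE filtF); exact: FOm.
have fin : \int[mu]_x (\1_(Om k) x * v x)%:E < +oo.
  by have := int_lty wv (FOm k) (Omfin k); rewrite int_indic.
have : \int[mu]_x (\1_(Om k) x * v x)%:E <= C%:E * \int[mu]_x (\1_(Om k) x * v x)%:E.
  rewrite -intZ ?(ltW C0)//; last exact: nnm_mul.
  rewrite [leLHS]cP//; apply: ae_ge0_le_integral => //.
  - by move=> x _; rewrite lee_fin; exact: (nnm_mul (nOm k) nc').2.
  - by apply/measurable_EFinP; exact: (nnm_mul (nOm k) nc').1.
  - move=> x _; rewrite lee_fin; apply: mulr_ge0; first exact: ltW.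
    exact: (nnm_mul (nOm k) nv).2.
  - by apply/measurable_EFinP; apply: measurable_funM => //; exact: (nnm_mul (nOm k) nv).1.
  move: vC (cond_exp_eq_nonneg filtF 0 wv); apply: filterS2 => x vCx <- _.
  rewrite lee_fin mulrCA ler_wpM2l ?(nOm k).2// -lee_fin.
  by apply: le_trans vCx; apply: ereal_sup_ubound; exists 0%R.
move: (int_ge0 mu (nnm_mul (nOm k) nv)) fin.
case: (\int[mu]_x (\1_(Om k) x * v x)%:E) => [y| |]//.
rewrite -EFinM !lee_fin => y0 _ yC.
rewrite leNgt; apply/negP => ygt0; move: yC.
by rewrite leNgt gtr_pMl// C1.
Qed.

Lemma bilinear_op_swap (f g : T -> R) :
  bilinear_op mu F alpha f g = bilinear_op mu F alpha g f.
Proof. by apply/funext => x; apply: eq_esum => i _; rewrite mulrAC. Qed.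

Lemma bilinear_bound_swap (p r : R) (sigma omega : T -> R) (C : R) :
  bilinear_bound mu F alpha p r sigma omega C ->
  bilinear_bound mu F alpha r p omega sigma C.
Proof.
move=> h f g f0 fL g0 gL; rewrite bilinear_op_swap muleAC.
exact: h.
Qed.

Lemma bilinear_bound_le (p r : R) (sigma omega : T -> R) (C C' : R) : (C <= C')%R ->
  bilinear_bound mu F alpha p r sigma omega C ->
  bilinear_bound mu F alpha p r sigma omega C'.
Proof.
move=> CC' h f g f0 fL g0 gL; apply: (le_trans (h f g f0 fL g0 gL)).
by apply: lee_wpmul2r; [exact: poweR_ge0|apply: lee_wpmul2r; [exact: poweR_ge0|]].
Qed.

Lemma bilinear_bound_null (p r : R) (sigma omega : T -> R) (C : R) :
  (1 < p)%R -> (1 < r)%R -> (0 < C)%R -> weight mu F sigma -> weight mu F omega ->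
  {ae mu, forall x, omega x = 0%R} ->
  bilinear_bound mu F alpha p r sigma omega C.
Proof.
move=> p1 r1 C0 wS wO O0 f g f0 fL g0 gL.
have wf := weight_mul filtF p1 wS f0 fL; have wg := weight_mul filtF r1 wO g0 gL.
apply: (@le_trans _ _ 0); last first.
  by rewrite !mule_ge0 ?poweR_ge0// lee_fin ltW.
rewrite (Lnorm_bilinear_op filtF admF)// esum1// => i _.
have [nfi _] := nonneg_cond_expP filtF i wf.
have [_ gP] := nonneg_cond_expP filtF i wg.
have nh : nnm_wrt (F i) (fun x => alpha i x * nonneg_cond_exp mu F i (f \* sigma)%R x)%R.
  exact: nnm_mul (admissible_nnm admF i) nfi.
rewrite -gP//.
rewrite (@eq_int_ae _ _ _ mu _ (fun=> 0%R)) ?integral0//.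
- exact: nnm_mul (nnm_sub (filtration_sub filtF i) nh) (weight_nnm wg).
- by move: O0; apply: filterS => x ox0; rewrite /= ox0 !mulr0.
Qed.

End degenerate_weights.

Section smallest_constants.
Context {R : realType}.

Lemma smallest_constant_ge0 (P : R -> Prop) : 0 <= smallest_constant P.
Proof. by apply: le_ereal_inf_tmp => _ [C [C0 _] <-]; rewrite lee_fin ltW. Qed.

Lemma smallest_constant_le (P : R -> Prop) (C : R) :
  (0 < C)%R -> P C -> smallest_constant P <= C%:E.
Proof. by move=> C0 PC; apply: ereal_inf_lbound; exists C. Qed.

Lemma le_smallest_constant (P Q : R -> Prop) : (forall C, (0 < C)%R -> P C -> Q C) ->
  smallest_constant Q <= smallest_constant P.
Proof.
move=> PQ; apply: le_ereal_inf_tmp => _ [C [C0 PC] <-].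
by apply: smallest_constant_le => //; exact: PQ.
Qed.

Lemma smallest_constant_eq0 (P : R -> Prop) : (forall C, (0 < C)%R -> P C) ->
  smallest_constant P = 0.
Proof.
move=> PC; apply/eqP; rewrite eq_le smallest_constant_ge0 andbT.
apply/lee_addgt0Pr => e e0; rewrite add0e.
by apply: smallest_constant_le => //; exact: PC.
Qed.

Lemma smallest_constant_ge1 (P : R -> Prop) :
  (forall C, (0 < C)%R -> P C -> (1 <= C)%R) -> 1 <= smallest_constant P.
Proof. by move=> P1; apply: le_ereal_inf_tmp => _ [C [C0 PC] <-]; rewrite lee_fin P1. Qed.

(** The two infima are taken one after the other, so that each subtraction is of
a finite quantity. *)
Lemma le_smallest_constantD (P Q : R -> Prop) (K : R) (X : \bar R) : (0 < K)%R ->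
  (forall C D, (0 < C)%R -> (0 < D)%R -> P C -> Q D -> X <= (K * (C + D))%:E) ->
  X <= K%:E * (smallest_constant P + smallest_constant Q).
Proof.
move=> K0 XK; rewrite -lee_pdivrMl//; set Z := _ * X.
have {}XK C D : (0 < C)%R -> (0 < D)%R -> P C -> Q D -> Z <= C%:E + D%:E.
  by move=> C0 D0 PC QD; rewrite lee_pdivrMl// -EFinD -EFinM XK.
have step D : (0 < D)%R -> Q D -> Z <= smallest_constant P + D%:E.
  move=> D0 QD; rewrite -leeBlDr//; apply: le_ereal_inf_tmp => _ [C [C0 PC] <-].
  by rewrite leeBlDr// XK.
have := smallest_constant_ge0 P; have := smallest_constant_ge0 Q.
move: step; case: (smallest_constant P) => [s| |]// step q0 s0; last first.
  by rewrite addye ?leey// gt_eqF// (lt_le_trans _ q0).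
rewrite addeC -leeBlDr//; apply: le_ereal_inf_tmp => _ [D [D0 QD] <-].
by rewrite leeBlDr// addeC step.
Qed.

End smallest_constants.

Theorem theorem1p1 (R : realType) (p q p' q' : R) (hp : (1 < p)%R)
    (hpq : (p <= q)%R) (hp' : (p^-1 + p'^-1 = 1)%R)
    (hq' : (q^-1 + q'^-1 = 1)%R) :
  exists2 K : R, (0 < K)%R &
  forall (d : measure_display) (T : measurableType d)
    (mu : {sigma_finite_measure set T -> \bar R})
    (F : int -> set (set T)) (alpha : int -> T -> R) (omega sigma : T -> R),
  sigma_finite_filtration mu F ->
  admissible_coefficients F alpha ->
  weight mu F omega -> weight mu F sigma ->
  A1 mu F omega -> A1 mu F sigma ->
  let boundA := bilinear_bound mu F alpha p q' sigma omega in
  let boundB := testing_bound mu F alpha p q sigma omega in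
  let boundC := testing_bound mu F alpha q' p' omega sigma in
  ((exists2 C : R, (0 < C)%R & boundA C) <->
   (exists C1 C2 : R, [/\ (0 < C1)%R, (0 < C2)%R, boundB C1 & boundC C2])) /\
  [/\ smallest_constant boundB <= smallest_constant boundA,
      smallest_constant boundC <= smallest_constant boundA &
      smallest_constant boundA <=
        K%:E * (smallest_constant boundB * A1_constant mu F omega +
                smallest_constant boundC * A1_constant mu F sigma)].
Proof.
have q1 : (1 < q)%R by exact: lt_le_trans hpq.
have p'1 := conjugate_gt1 hp hp'; have q'1 := conjugate_gt1 q1 hq'.
have form0 : (0 <= form_constant p q p' q')%R.
  by apply: addr_ge0; apply: half_constant_ge0 => //; rewrite addrC.
exists (form_constant p q p' q' + 1)%R; first exact: ltr_wpDl.
set K := (_ + 1)%R; have K0 : (0 < K)%R by exact: ltr_wpDl.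
move=> d T mu F alpha omega sigma filtF admF wO wS _ _ boundA boundB boundC.
have AB C : (0 < C)%R -> boundA C -> boundB C.
  by move=> C0; apply: testing_bound_of_bilinear => //; exact: ltW.
have AC C : (0 < C)%R -> boundA C -> boundC C.
  move=> C0 /bilinear_bound_swap.
  by apply: testing_bound_of_bilinear => //; [rewrite addrC|exact: ltW].
have BCA C1 C2 : (0 < C1)%R -> (0 < C2)%R -> boundB C1 -> boundC C2 ->
    boundA (K * (C1 + C2))%R.
  move=> C10 C20 B1 B2.
  apply: (@bilinear_bound_le _ _ _ _ _ _ _ _ _ _ (form_constant p q p' q' * (C1 + C2))%R).
    apply: ler_wpM2r; first by rewrite addr_ge0// ltW.
    by rewrite /K lerDl.
  by apply: bilinear_bound_of_testing => //; exact: ltW.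
split.
  split=> [[C C0 AC0]|[C1 [C2 [C10 C20 B1 B2]]]].
    by exists C, C; split => //; [exact: AB|exact: AC].
  by exists (K * (C1 + C2))%R; [rewrite mulr_gt0// addr_gt0|exact: BCA].
split; [exact: le_smallest_constant|exact: le_smallest_constant|].
have B0 := smallest_constant_ge0 boundB; have C0 := smallest_constant_ge0 boundC.
have O0 := smallest_constant_ge0 (A1_bound mu F omega).
have S0 := smallest_constant_ge0 (A1_bound mu F sigma).
have null : (forall C, (0 < C)%R -> boundA C) ->
    smallest_constant boundA <= K%:E * (smallest_constant boundB * A1_constant mu F omega +
                smallest_constant boundC * A1_constant mu F sigma).
  move=> /smallest_constant_eq0 ->; apply: mule_ge0; first by rewrite lee_fin ltW.
  by apply: adde_ge0; exact: mule_ge0.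
have [[c c0 [c1 Oc]]|nO] := pselect (exists2 c : R, (0 < c)%R & (c < 1)%R /\ A1_bound mu F omega c).
  by apply: null => C ?; apply: bilinear_bound_null => //; exact: A1_bound_lt1 Oc.
have [[c c0 [c1 Sc]]|nS] := pselect (exists2 c : R, (0 < c)%R & (c < 1)%R /\ A1_bound mu F sigma c).
  apply: null => C ?; apply: bilinear_bound_swap; apply: bilinear_bound_null => //.
  exact: A1_bound_lt1 Sc.
have O1 : 1 <= A1_constant mu F omega.
  apply: smallest_constant_ge1 => c c0 Oc; rewrite leNgt; apply/negP => c1.
  by apply: nO; exists c.
have S1 : 1 <= A1_constant mu F sigma.
  apply: smallest_constant_ge1 => c c0 Sc; rewrite leNgt; apply/negP => c1.
  by apply: nS; exists c.
apply: (@le_trans _ _ (K%:E * (smallest_constant boundB + smallest_constant boundC))).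
  apply: le_smallest_constantD => // C1 C2 C10 C20 B1 B2.
  by apply: smallest_constant_le; [rewrite mulr_gt0// addr_gt0|exact: BCA].
apply: lee_wpmul2l; first by rewrite lee_fin ltW.
by apply: leeD; exact: lee_pemulr.
Qed.
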